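(* Consider binary floating-point arithmetic with precision $p\ge 5$ and unit round-off $u=2^{-p}$, all operations correctly rounded to nearest ($\mathrm{RN}$), an FMA available, and no underflow or overflow. Let $R_2=\mathrm{RN}(\sqrt2)$, $P_h=\mathrm{RN}(1+\sqrt2)$, $P_\ell=\mathrm{RN}(1+\sqrt2-P_h)$. For floating-point inputs $0\le y\le x$ consider the algorithm: $\delta\gets\mathrm{RN}(x-y)$. If $\delta>y$: $r\gets\mathrm{RN}(x/y)$, $t\gets\mathrm{RN}(1+r^2)$, $s\gets\mathrm{RN}(\sqrt t)$, $z\gets\mathrm{RN}(r+s)$. Otherwise: $r_2\gets\mathrm{RN}(\delta/y)$, $tr_2\gets\mathrm{RN}(2r_2)$, $r_3\gets\mathrm{RN}(tr_2+r_2^2)$ (one FMA, single rounding), $r_4\gets\mathrm{RN}(2+r_3)$, $s_2\gets\mathrm{RN}(\sqrt{r_4})$, $d\gets\mathrm{RN}(R_2+s_2)$, $q\gets\mathrm{RN}(r_3/d)$, $r_5\gets\mathrm{RN}(P_\ell+q)$, $r_6\gets\mathrm{RN}(r_5+r_2)$, $z\gets\mathrm{RN}(P_h+r_6)$. Finally, in both cases, $z_2\gets\mathrm{RN}(y/z)$ and $\rho_5\gets\mathrm{RN}(x+z_2)$. Then the relative error $|\rho_5/\sqrt{x^2+y^2}-1|$ is bounded by \[ \phi(u) = \frac{\left(1+\dfrac{1+u(1-2u)}{1+\sqrt2-\frac{u(2+u)(1+2u)^2}{(1+u)^2}}\right)(1+2u)}{\left(1+\frac{1}{1+\sqrt2}\right)(1+u)}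 - 1, \] which satisfies $\phi(u) = \left(\frac{5\sqrt2}{2}-2\right)u + \left(30-\frac{39\sqrt2}{2}\right)u^3 + O(u^4)$ and $\phi(u)\le \left(\frac{5\sqrt2}{2}-2\right)u + \frac{u^2}{12}$ for $0\le u\le 1/32$.
   Context: A radix-2 floating-point number of precision $p$ has the form $M\cdot 2^{e-p+1}$ with integers $|M|\le 2^p-1$ and $e_{\min}\le e\le e_{\max}$. $\mathrm{RN}$ is rounding to nearest (ties-to-even). An FMA computes $\mathrm{RN}(ab+c)$ with a single rounding. ''No underflow or overflow'' means all nonzero intermediate results lie in the normal range. *)

(* Defs.v *)
From Stdlib Require Import Reals Lra ZArith ClassicalEpsilon.
Open Scope R_scope.

(* Radix-2 floating-point numbers of precision p with UNBOUNDED exponent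
   range: this models the standing assumption "no underflow or overflow". *)
Definition is_fp (p : nat) (x : R) : Prop :=
  exists (M e : Z), IZR (Z.abs M) < 2 ^ p /\ x = IZR M * powerRZ 2 e.

(* x has a representation with an even integral significand; for a float
   this holds iff its normalized significand is even (or it is 0). *)
Definition is_fp_even (p : nat) (x : R) : Prop :=
  exists (M e : Z), IZR (Z.abs M) < 2 ^ p /\ Z.even M = true /\
                    x = IZR M * powerRZ 2 e.

Definition is_RN (p : nat) (x r : R) : Prop :=
  is_fp p r /\
  (forall f, is_fp p f -> Rabs (x - r) <= Rabs (x - f)) /\
  (forall f, is_fp p f -> f <> r -> Rabs (x - f) = Rabs (x - r) -> is_fp_even p r).

(* RN as a function (the relation is functional and total). *)
Definition RN (p : nat) (x : R) : R :=
  epsilon (inhabits 0) (fun r => is_RN p x r).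

Definition unit_roundoff (p : nat) : R := / 2 ^ p.

Definition hypot_alg (p : nat) (x y : R) : R :=
  let RNp := RN p in
  let R2 := RNp (sqrt 2) in
  let Ph := RNp (1 + sqrt 2) in
  let Pl := RNp (1 + sqrt 2 - Ph) in
  let delta := RNp (x - y) in
  let z :=
    if Rlt_dec y delta then
      let r := RNp (x / y) in
      let t := RNp (1 + r * r) in
      let s := RNp (sqrt t) in
      RNp (r + s)
    else
      let r2 := RNp (delta / y) in
      let tr2 := RNp (2 * r2) in
      let r3 := RNp (tr2 + r2 * r2) in
      let r4 := RNp (2 + r3) in
      let s2 := RNp (sqrt r4) in
      let d := RNp (R2 + s2) in
      let q := RNp (r3 / d) in
      let r5 := RNp (Pl + q) in
      let r6 := RNp (r5 + r2) in
      RNp (Ph + r6) in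
  let z2 := RNp (y / z) in
  RNp (x + z2).

Definition phi (u : R) : R :=
  ((1 + (1 + u * (1 - 2 * u)) /
        (1 + sqrt 2 - u * (2 + u) * (1 + 2 * u) ^ 2 / (1 + u) ^ 2))
   * (1 + 2 * u))
  / ((1 + 1 / (1 + sqrt 2)) * (1 + u)) - 1.

(* Main.v *)
Require Import Defs.
From Stdlib Require Import Reals ZArith Lra Lia Psatz ClassicalEpsilon.
Open Scope R_scope.

(** Put [r = x/y], [s = sqrt (1 + r^2)], [Z = r + s]; then
    [sqrt (x^2 + y^2) = x + y/Z = y s].  As [phi u >= (5 sqrt 2 / 2 - 2) u] and the
    last rounding contributes at most [u/(1+u)], it suffices that [x + z2]
    has relative error at most [(0.5355 + 0.43 u) u].

    For [r >= 2] crude bounds are enough, because [y/Z] is then a small part of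
    the sum.  For [r <= 2] the difference [x - y] is exact, and
    [r - 1] is split into 15 intervals on which every intermediate rounding error
    of [z] is bounded by a constant multiple of [u].  The extreme case is [r] close to [1],
    where bounding the errors of [y/z] and of the final sum separately leaves no
    room; but these two errors cannot be maximal together (see [final_paired]). *)

(** [0.5355] is [5 * sqrt 2 / 2 - 3] rounded down: what remains of the linear coefficient once the
    last rounding has taken [1]. If [e * u] bounds the error of [z], then dividing the error of
    [x + z2] by [u * y] and multiplying by [z * Z] turns the requirement, to first order in [u],
    into [e + Z <= 0.5355 * s * Z ^ 2]. At [r = 1] this leaves just under [2] for [e], and since [Z]
    is about [2.41] the rounding of [z] alone may cost [2 * u]. Pairing replaces the requirement by
    [e <= 0.2855 * s * Z ^ 2], about [2.35]. The other operations fit into the difference because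
    near [r = 1] the algorithm only adds small corrections to a constant, so most of their errors
    are small fractions of [u]. Bounds on rounding errors double when the argument passes a power of
    two, which forces the subdivision into intervals. Second-order terms are absorbed by
    [u <= 1 / 32], so one set of numerical checks serves every precision. *)

Local Notation pw := (powerRZ 2).

Lemma Rabs_between a b : Rabs a <= b -> - b <= a <= b.
Proof. unfold Rabs. destruct Rcase_abs; lra. Qed.

Lemma pw_pos e : 0 < pw e.
Proof. apply powerRZ_lt; lra. Qed.

Lemma pw_add a b : pw (a + b) = pw a * pw b.
Proof. apply powerRZ_add; lra. Qed.

Lemma pw_of_nat n : pw (Z.of_nat n) = 2 ^ n.
Proof. symmetry; apply pow_powerRZ. Qed.

Lemma pw_le a b : (a <= b)%Z -> pw a <= pw b.
Proof.
  intros H. replace b with (a + Z.of_nat (Z.to_nat (b - a)))%Z by lia.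
  rewrite pw_add, pw_of_nat.
  assert (H1 := pow_R1_Rle 2 (Z.to_nat (b - a)) ltac:(lra)).
  pose proof (pw_pos a). nra.
Qed.

Lemma pw_IZR e : (0 <= e)%Z -> pw e = IZR (2 ^ e).
Proof.
  intros H. replace e with (Z.of_nat (Z.to_nat e)) by lia.
  rewrite pw_of_nat, pow_IZR. reflexivity.
Qed.

Lemma binade t : 0 < t -> exists k, pw k <= t < pw (k + 1).
Proof.
  intros Ht. set (l := ln t / ln 2).
  assert (Hl2 : 0 < ln 2) by (rewrite <- ln_1; apply ln_increasing; lra).
  assert (Hl : t = Rpower 2 l).
  { unfold Rpower, l. replace (ln t / ln 2 * ln 2) with (ln t) by (field; lra).
    symmetry; apply exp_ln; lra. }
  destruct (base_Int_part l) as [H1 H2].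
  exists (Int_part l). rewrite !powerRZ_Rpower by lra. rewrite plus_IZR. split.
  - rewrite Hl. apply Rle_Rpower; lra.
  - rewrite Hl. apply Rpower_lt; lra.
Qed.

(** * Floats and existence of rounding to nearest even *)

Lemma nearest_even X : exists m : Z,
  Rabs (X - IZR m) <= 1 / 2 /\ (Rabs (X - IZR m) = 1 / 2 -> Z.even m = true).
Proof.
  destruct (base_Int_part X) as [H1 H2]. set (n := Int_part X) in *.
  destruct (Rtotal_order (X - IZR n) (1 / 2)) as [H|[H|H]].
  - exists n. rewrite Rabs_right by lra. split; [lra | intros; lra].
  - destruct (Z.even n) eqn:En.
    + exists n. rewrite Rabs_right by lra. split; [lra | easy].
    + exists (n + 1)%Z. rewrite plus_IZR, Rabs_left by lra. split; [lra|].
      intros _. rewrite Z.even_add, En. reflexivity.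
  - exists (n + 1)%Z. rewrite plus_IZR, Rabs_left by lra. split; [lra | intros; lra].
Qed.

Lemma nearest_int_min X m n :
  Rabs (X - IZR m) <= 1 / 2 -> Rabs (X - IZR m) <= Rabs (X - IZR n).
Proof.
  intros H. destruct (Z.eq_dec m n) as [->|Hn]; [lra|].
  assert (1 <= Rabs (IZR m - IZR n)).
  { rewrite <- minus_IZR, <- abs_IZR. apply IZR_le. lia. }
  revert H H0. unfold Rabs. repeat destruct Rcase_abs; lra.
Qed.

Lemma fp_of_int p m e : (1 <= p)%nat -> IZR (Z.abs m) <= 2 ^ p -> is_fp p (IZR m * pw e).
Proof.
  intros Hp Hm.
  destruct (Rle_lt_or_eq_dec _ _ Hm) as [H|H]; [now exists m, e|].
  assert (E : 2 ^ p = 2 * 2 ^ (p - 1)).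
  { replace p with (S (p - 1)) at 1 by lia. reflexivity. }
  assert (P := pow_lt 2 (p - 1) ltac:(lra)).
  exists (Z.sgn m * 2 ^ Z.of_nat (p - 1))%Z, (e + 1)%Z.
  assert (Hs : IZR m = IZR (Z.sgn m) * 2 ^ p).
  { rewrite <- H, <- mult_IZR. f_equal. lia. }
  rewrite mult_IZR, <- pow_IZR, pw_add. split.
  - rewrite Z.abs_mul, mult_IZR, (Z.abs_eq (2 ^ _)), <- pow_IZR by (apply Z.pow_nonneg; lia).
    assert (IZR (Z.abs (Z.sgn m)) <= 1) by (apply IZR_le; lia). nra.
  - rewrite Hs, E. simpl. ring.
Qed.

Lemma fp_multiple p k f : is_fp p f -> pw k <= Rabs f ->
  exists m : Z, f = IZR m * pw (k - Z.of_nat p + 1).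
Proof.
  intros (M & e & HM & ->) Hk.
  destruct (Z_le_gt_dec (k - Z.of_nat p + 1) e) as [H|H].
  - exists (M * 2 ^ (e - (k - Z.of_nat p + 1)))%Z.
    rewrite mult_IZR, <- pw_IZR, Rmult_assoc, <- pw_add by lia. f_equal. f_equal. lia.
  - exfalso. rewrite Rabs_mult, <- abs_IZR, (Rabs_right (pw e)) in Hk
      by (apply Rle_ge, Rlt_le, pw_pos).
    assert (H1 : pw (Z.of_nat p + e) <= pw k) by (apply pw_le; lia).
    rewrite pw_add, pw_of_nat in H1. pose proof (pw_pos e). nra.
Qed.

Lemma fp_0 p : is_fp p 0.
Proof. exists 0%Z, 0%Z. split; [apply pow_lt; lra | simpl; ring]. Qed.

Lemma fp_opp p f : is_fp p f -> is_fp p (- f).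
Proof.
  intros (M & e & H & ->). exists (- M)%Z, e.
  rewrite Z.abs_opp, opp_IZR. split; [assumption | ring].
Qed.

Lemma fp_even_opp p f : is_fp_even p f -> is_fp_even p (- f).
Proof.
  intros (M & e & H & H' & ->). exists (- M)%Z, e.
  rewrite Z.abs_opp, Z.even_opp, opp_IZR. repeat split; try assumption; ring.
Qed.

Lemma is_RN_opp p t r : is_RN p t r -> is_RN p (- t) (- r).
Proof.
  intros (H1 & H2 & H3). split; [now apply fp_opp|].
  assert (A : forall f, Rabs (- t - f) = Rabs (t - - f)).
  { intros f. rewrite <- Rabs_Ropp. f_equal. ring. }
  split.
  - intros f Hf. rewrite !A, Ropp_involutive. now apply H2, fp_opp.
  - intros f Hf Hne. rewrite !A, Ropp_involutive. intros E.
    apply fp_even_opp, (H3 (- f)); [now apply fp_opp | intros E'; apply Hne; lra | exact E].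
Qed.

(** [pw (k - p + 1)] is the spacing of the floats between [2^k] and [2^(k+1)]; half of it is
    [u * 2^k], the source of all absolute error bounds below. *)
Lemma ulp_scale p k : pw k = 2 ^ p * (pw (k - Z.of_nat p + 1) / 2).
Proof.
  rewrite <- pw_of_nat.
  replace (pw (k - Z.of_nat p + 1)) with (pw (k - Z.of_nat p) * 2) by (rewrite pw_add; simpl; ring).
  replace k with (Z.of_nat p + (k - Z.of_nat p))%Z at 1 by lia.
  rewrite pw_add. field.
Qed.

(** [RN] is chosen by [epsilon], so its properties rest on this existence. Floats from [2^k] on are
    multiples of the spacing [g], which reduces the problem to rounding [t / g] to an integer. *)
Lemma RN_exists_pos p t : (2 <= p)%nat -> 0 < t -> exists r, is_RN p t r.
Proof.
  intros Hp Ht. destruct (binade t Ht) as (k & Hk1 & Hk2).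
  set (g := pw (k - Z.of_nat p + 1)).
  assert (Hg : 0 < g) by apply pw_pos.
  assert (Ek := ulp_scale p k). fold g in Ek.
  assert (E1 : pw (k + 1) = 2 ^ p * g) by (rewrite pw_add, Ek; simpl; field).
  assert (E2 : 2 ^ p = 2 * IZR (2 ^ Z.of_nat (p - 1))).
  { rewrite <- pow_IZR. replace p with (S (p - 1)) at 1 by lia. reflexivity. }
  set (P1 := (2 ^ Z.of_nat (p - 1))%Z) in *.
  assert (Ek' : pw k = IZR P1 * g) by (rewrite Ek, E2; field).
  destruct (nearest_even (t / g)) as (m & Hm & Hev).
  assert (D : forall n, Rabs (t - IZR n * g) = Rabs (t / g - IZR n) * g).
  { intros n. rewrite <- (Rabs_right g) at 3 by lra. rewrite <- Rabs_mult.
    f_equal. field. lra. }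
  assert (Hm0 : (0 <= m)%Z).
  { apply Z.lt_pred_le. apply lt_IZR. unfold Z.pred. rewrite plus_IZR.
    assert (0 < t / g) by (apply Rdiv_lt_0_compat; lra).
    apply Rabs_between in Hm. lra. }
  assert (Hm1 : IZR (Z.abs m) <= 2 ^ p).
  { rewrite Z.abs_eq by assumption.
    assert (t / g < 2 ^ p) by (apply Rmult_lt_reg_r with g; [lra|];
      replace (t / g * g) with t by (field; lra); lra).
    rewrite pow_IZR in *. apply IZR_le. apply Z.lt_succ_r, lt_IZR.
    unfold Z.succ. rewrite plus_IZR. apply Rabs_between in Hm. lra. }
  exists (IZR m * g).
  (* Since [pw k] is itself a multiple of [g], floats below the binade are strictly worse, and only
     multiples of [g] remain as competitors. *)
  assert (Hlow : forall f, f < pw k -> Rabs (t - IZR m * g) < Rabs (t - f)).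
  { intros f Hf. apply Rle_lt_trans with (Rabs (t - IZR P1 * g)).
    - rewrite !D. apply Rmult_le_compat_r; [lra|]. now apply nearest_int_min.
    - rewrite !Rabs_right; lra. }
  split; [apply fp_of_int; [lia | assumption]|].
  split.
  - intros f Hf. destruct (Rlt_le_dec f (pw k)) as [H|H]; [now apply Rlt_le, Hlow|].
    destruct (fp_multiple p k f Hf) as (n & ->).
    { rewrite Rabs_right; [assumption | pose proof (pw_pos k); lra]. }
    fold g. rewrite !D. apply Rmult_le_compat_r; [lra|]. now apply nearest_int_min.
  - intros f Hf Hne E. destruct (Rlt_le_dec f (pw k)) as [H|H].
    { specialize (Hlow f H). lra. }
    destruct (fp_multiple p k f Hf) as (n & ->).
    { rewrite Rabs_right; [assumption | pose proof (pw_pos k); lra]. }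
    fold g in E, Hne. rewrite !D in E. apply Rmult_eq_reg_r in E; [|lra].
    assert (Hmn : m <> n) by (intros ->; now apply Hne).
    assert (Hh : Rabs (t / g - IZR m) = 1 / 2).
    { assert (1 <= Rabs (IZR m - IZR n)).
      { rewrite <- minus_IZR, <- abs_IZR. apply IZR_le. lia. }
      revert Hm E H0. unfold Rabs. repeat destruct Rcase_abs; lra. }
    specialize (Hev Hh).
    destruct (Rle_lt_or_eq_dec _ _ Hm1) as [Hlt|Heq].
    + exists m, (k - Z.of_nat p + 1)%Z. now repeat split.
    (* Here [t] is rounded up to [2^(k+1)]; after renormalization the significand is [2 ^ (p - 1)],
       even because [p >= 2]. *)
    + rewrite Z.abs_eq in Heq by assumption.
      exists P1, (k - Z.of_nat p + 1 + 1)%Z.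
      assert (0 < P1)%Z by (apply Z.pow_pos_nonneg; lia).
      rewrite Z.abs_eq by lia. repeat split.
      * rewrite E2. assert (1 <= IZR P1) by (apply IZR_le; lia). lra.
      * unfold P1. replace (Z.of_nat (p - 1)) with (Z.succ (Z.of_nat (p - 2))) by lia.
        rewrite Z.pow_succ_r by lia. now rewrite Z.even_mul.
      * rewrite pw_add. fold g. rewrite Heq, E2. simpl. ring.
Qed.

Lemma RN_spec p t : (2 <= p)%nat -> is_RN p t (RN p t).
Proof.
  intros Hp. unfold RN. apply epsilon_spec.
  destruct (Rtotal_order t 0) as [H|[->|H]].
  - destruct (RN_exists_pos p (- t) Hp ltac:(lra)) as (r & Hr).
    exists (- r). rewrite <- (Ropp_involutive t). now apply is_RN_opp.
  - exists 0. split; [apply fp_0|].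
    assert (E : Rabs (0 - 0) = 0) by (rewrite Rminus_0_r; apply Rabs_R0).
    split.
    + intros f _. rewrite E. apply Rabs_pos.
    + intros f _ Hne. rewrite E. intros H. exfalso. apply Hne.
      apply Req_le, Rabs_between in H. lra.
  - now apply RN_exists_pos.
Qed.

Lemma RN_fp p t : (2 <= p)%nat -> is_fp p (RN p t).
Proof. intros Hp. apply (RN_spec p t Hp). Qed.

Lemma RN_nearest p t f : (2 <= p)%nat -> is_fp p f -> Rabs (RN p t - t) <= Rabs (f - t).
Proof.
  intros Hp Hf. rewrite (Rabs_minus_sym _ t), (Rabs_minus_sym f).
  now apply (RN_spec p t Hp).
Qed.

Lemma RN_id p f : (2 <= p)%nat -> is_fp p f -> RN p f = f.
Proof.
  intros Hp Hf. assert (H := RN_nearest p f f Hp Hf).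
  rewrite Rminus_diag, Rabs_R0 in H.
  apply Rabs_between in H. lra.
Qed.

(** * Absolute and relative rounding error bounds *)

Lemma u_pos p : 0 < unit_roundoff p.
Proof. apply Rinv_0_lt_compat, pow_lt; lra. Qed.

Lemma u_pw p : unit_roundoff p = pw (- Z.of_nat p).
Proof. unfold unit_roundoff. now rewrite powerRZ_neg', pw_of_nat. Qed.

Lemma u_le p : (5 <= p)%nat -> unit_roundoff p <= 1 / 32.
Proof.
  intros H. rewrite u_pw. replace (1 / 32) with (pw (-5)) by (simpl; lra).
  apply pw_le. lia.
Qed.

(** Stated for a whole range of arguments, so that one numerical [k] per operation holds uniformly
    over an interval of inputs. *)
Definition round_bound p k T :=
  forall t, Rabs t <= T -> Rabs (RN p t - t) <= unit_roundoff p * k.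

Lemma round_bound_pw p j : (2 <= p)%nat -> round_bound p (pw j) (2 * pw j).
Proof.
  intros Hp t Ht. set (g := pw (j - Z.of_nat p + 1)).
  assert (Hg : 0 < g) by apply pw_pos.
  assert (Ej := ulp_scale p j). fold g in Ej.
  destruct (nearest_even (t / g)) as (m & Hm & _).
  assert (Hp2 := pow_lt 2 p ltac:(lra)).
  assert (Htg : Rabs (t / g) <= 2 ^ p).
  { unfold Rdiv. rewrite Rabs_mult, (Rabs_right (/ g)) by (left; now apply Rinv_0_lt_compat).
    apply Rmult_le_reg_r with g; [lra|]. rewrite Rmult_assoc, Rinv_l by lra. lra. }
  eapply Rle_trans; [apply (RN_nearest p t (IZR m * g)); [assumption|]|].
  - apply fp_of_int; [lia|].
    rewrite pow_IZR in *. apply IZR_le, Z.lt_succ_r, lt_IZR.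
    unfold Z.succ. rewrite plus_IZR, abs_IZR.
    revert Hm Htg. unfold Rabs. repeat destruct Rcase_abs; lra.
  - replace (IZR m * g - t) with (- ((t / g - IZR m) * g)) by (field; lra).
    rewrite Rabs_Ropp, Rabs_mult, (Rabs_right g) by lra.
    unfold unit_roundoff. rewrite Ej, <- Rmult_assoc, Rinv_l by lra. nra.
Qed.

Lemma RN_err_binade p t k : (2 <= p)%nat -> pw k <= t < pw (k + 1) ->
  Rabs (RN p t - t) <= unit_roundoff p * pw k.
Proof.
  intros Hp [H1 H2]. apply round_bound_pw; [assumption|]. rewrite pw_add in H2. simpl in H2.
  pose proof (pw_pos k). rewrite Rabs_right; lra.
Qed.

Lemma RN_rel_pos p t : (2 <= p)%nat -> 0 < t ->
  Rabs (RN p t - t) <= unit_roundoff p / (1 + unit_roundoff p) * t.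
Proof.
  intros Hp Ht. destruct (binade t Ht) as (k & Hk).
  assert (E1 := RN_err_binade p t k Hp Hk).
  assert (Hf : is_fp p (pw k)).
  { replace (pw k) with (IZR 1 * pw k) by ring. apply fp_of_int; [lia|].
    apply pow_R1_Rle; lra. }
  assert (E2 := RN_nearest p t _ Hp Hf).
  set (u := unit_roundoff p) in *. assert (Hu : 0 < u) by apply u_pos.
  rewrite (Rabs_left1 (pw k - t)) in E2 by lra.
  apply Rmult_le_reg_l with (1 + u); [lra|].
  replace ((1 + u) * (u / (1 + u) * t)) with (u * t) by (field; lra).
  (* From [(1 + u) * 2^k] on, the absolute bound [u * 2^k] suffices; below it, the float [2^k] is
     close enough to [t]. *)
  destruct (Rle_dec ((1 + u) * pw k) t); nra.
Qed.

(** [- RN p (- t)] is a float and hence a competitor for [t]; this settles negative arguments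
    without showing that [RN] is odd. *)
Lemma RN_opp_err p t : (2 <= p)%nat -> Rabs (RN p t - t) <= Rabs (RN p (- t) - - t).
Proof.
  intros Hp. replace (RN p (- t) - - t) with (- (- RN p (- t) - t)) by ring.
  rewrite Rabs_Ropp. apply RN_nearest; [assumption|]. now apply fp_opp, RN_fp.
Qed.

Lemma round_bound_rel p T : (2 <= p)%nat -> round_bound p T T.
Proof.
  intros Hp t Ht. assert (Hu := u_pos p). set (u := unit_roundoff p) in *.
  assert (Hr : forall a, 0 < a -> u / (1 + u) * a <= u * a).
  { intros a Ha. apply Rmult_le_compat_r; [lra|]. apply Rmult_le_reg_r with (1 + u); [lra|].
    unfold Rdiv. rewrite Rmult_assoc, Rinv_l by lra. nra. }
  destruct (Rtotal_order t 0) as [H|[->|H]].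
  - rewrite Rabs_left in Ht by lra.
    assert (H1 := RN_opp_err p t Hp).
    assert (H2 := RN_rel_pos p (- t) Hp ltac:(lra)). fold u in H2.
    specialize (Hr (- t) ltac:(lra)). nra.
  - rewrite RN_id, Rminus_diag, Rabs_R0 by (try apply fp_0; assumption).
    rewrite Rabs_R0 in Ht. nra.
  - rewrite Rabs_right in Ht by lra.
    assert (H2 := RN_rel_pos p t Hp ltac:(lra)). fold u in H2.
    specialize (Hr t ltac:(lra)). nra.
Qed.

Lemma RN_rel p t : (2 <= p)%nat -> Rabs (RN p t - t) <= unit_roundoff p * Rabs t.
Proof. intros Hp. apply round_bound_rel; [assumption|]. lra. Qed.

Lemma RN_le_fp p t f : (2 <= p)%nat -> is_fp p f -> t <= f -> RN p t <= f.
Proof.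
  intros Hp Hf Ht. destruct (Rle_lt_dec (RN p t) f) as [H|H]; [assumption|].
  assert (E := RN_nearest p t f Hp Hf). rewrite !Rabs_right in E; lra.
Qed.

(** * Exact subtraction and the sharper bound for quotients *)

Lemma fp_normal p y : is_fp p y -> 0 < y -> exists k m,
  pw k <= y /\ y = IZR m * pw (k - Z.of_nat p + 1) /\ (0 < m < 2 ^ Z.of_nat p)%Z.
Proof.
  intros Hf Hy. destruct (binade y Hy) as (k & H1 & H2).
  destruct (fp_multiple p k y Hf) as (m & Hm); [rewrite Rabs_right; lra|].
  exists k, m. split; [assumption|]. split; [assumption|].
  assert (E := ulp_scale p k). assert (Hg := pw_pos (k - Z.of_nat p + 1)).
  rewrite pw_add in H2. set (g := pw (k - Z.of_nat p + 1)) in *. simpl in H2.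
  split; apply lt_IZR.
  - apply Rmult_lt_reg_r with g; lra.
  - rewrite <- pow_IZR. apply Rmult_lt_reg_r with g; lra.
Qed.

(** Sterbenz's theorem, except that the algorithm tests the rounded difference, so [x <= 2 * y] has
    to be recovered from it. *)
Lemma RN_sub_exact p x y : (2 <= p)%nat -> is_fp p x -> is_fp p y -> 0 < y <= x ->
  RN p (x - y) <= y -> x - y <= y /\ RN p (x - y) = x - y.
Proof.
  intros Hp Hx Hy [Hy0 Hyx] Hd.
  destruct (fp_normal p y Hy Hy0) as (k & m & Hk & Em & Hm).
  assert (Hg := pw_pos (k - Z.of_nat p + 1)).
  destruct (Rle_lt_dec (x - y) y) as [H|H].
  - split; [assumption|]. apply RN_id; [assumption|].
    destruct (fp_multiple p k x Hx) as (n & En); [rewrite Rabs_right; lra|].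
    replace (x - y) with (IZR (n - m) * pw (k - Z.of_nat p + 1))
      by (rewrite minus_IZR, En, Em; ring).
    rewrite En, Em in *.
    set (g := pw (k - Z.of_nat p + 1)) in *.
    apply fp_of_int; [lia|]. rewrite pow_IZR. apply IZR_le.
    assert (m <= n)%Z by (apply le_IZR, Rmult_le_reg_r with g; lra).
    assert (n - m <= m)%Z by (apply le_IZR; rewrite minus_IZR; apply Rmult_le_reg_r with g; lra).
    lia.
  (* Monotonicity of rounding would not exclude [RN p (x - y) = y]. But [x > 2 * y] is a multiple of
     twice the spacing [g] of [y = m * g], so [x - y >= (m + 2) * g], and the float [(m + 1) * g] is
     nearer than anything up to [y]. *)
  - exfalso.
    destruct (fp_multiple p (k + 1) x Hx) as (n & En).
    { rewrite Rabs_right, pw_add by lra. simpl. lra. }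
    replace (k + 1 - Z.of_nat p + 1)%Z with (k - Z.of_nat p + 1 + 1)%Z in En by ring.
    rewrite pw_add in En.
    set (g := pw (k - Z.of_nat p + 1)) in *. simpl in En.
    assert (m < n)%Z by (apply lt_IZR, Rmult_lt_reg_r with g; lra).
    assert (Hn : IZR m + 1 <= IZR n) by (rewrite <- plus_IZR; apply IZR_le; lia).
    assert (Hf : is_fp p (IZR (m + 1) * g)).
    { apply fp_of_int; [lia|]. rewrite pow_IZR. apply IZR_le. lia. }
    assert (E := RN_nearest p (x - y) _ Hp Hf). rewrite plus_IZR in E.
    assert (g * (IZR m + 1) <= g * IZR n) by (apply Rmult_le_compat_l; lra).
    rewrite !Rabs_left1 in E; lra.
Qed.

(** The left end is sharp: [1 + u - 2 * u^2 = (1 - u) * (1 + 2 * u)], so equality holds at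
    [T = 1 / (1 - u)]. *)
Lemma div_scaled_err u T : 0 < u <= 1 / 8 -> 1 + u / (1 - u) <= T -> T <= 1 + 3 * u ->
  Rabs (1 + 2 * u - T) <= u * (1 - 2 * u) * T.
Proof.
  intros Hu H1 H2.
  assert (H3 : 1 <= (1 - u) * T).
  { apply Rle_trans with ((1 - u) * (1 + u / (1 - u))); [right; field; lra|].
    apply Rmult_le_compat_l; lra. }
  assert (H4 : 1 + 2 * u <= (1 - u) * T * (1 + 2 * u)) by nra.
  assert (H5 : (1 - u + 2 * u * u) * T <= (1 - u + 2 * u * u) * (1 + 3 * u))
    by (apply Rmult_le_compat_l; nra).
  unfold Rabs. destruct Rcase_abs; nra.
Qed.

(** The worst relative errors sit just above a power of two, where a quotient of floats cannot lie:
    scaled to [T] in [[1, 2)], it is [1] or at least [1 + u / (1 - u)]. Up to [1 + 3 * u] the float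
    [1 + 2 * u] is compared; beyond, the absolute bound is enough. The gain over [u] becomes the
    factor [15 / 16] in [corner_check]; on [[1/8, 0.135]] that test would fail with [1] instead. *)
Lemma RN_div p a b : (3 <= p)%nat -> is_fp p a -> is_fp p b -> 0 < a -> 0 < b ->
  Rabs (RN p (a / b) - a / b) <= unit_roundoff p * (1 - 2 * unit_roundoff p) * (a / b).
Proof.
  intros Hp Ha Hb Ha0 Hb0.
  destruct (fp_normal p b Hb Hb0) as (kb & B & _ & EB & HB).
  destruct (fp_normal p a Ha Ha0) as (ka & A & _ & EA & HA).
  assert (Hab : 0 < a / b) by now apply Rdiv_lt_0_compat.
  assert (Hu := u_pos p). assert (Hu8 : unit_roundoff p <= 1 / 8).
  { rewrite u_pw. replace (1 / 8) with (pw (-3)) by (simpl; lra). apply pw_le. lia. }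
  destruct (binade (a / b) Hab) as (k & Hk1 & Hk2).
  assert (Hpk := pw_pos k). set (T := a / b / pw k).
  assert (ET : a / b = T * pw k) by (unfold T; field; lra).
  assert (HT1 : 1 <= T) by (apply Rmult_le_reg_r with (pw k); lra).
  assert (HT2 : T < 2).
  { apply Rmult_lt_reg_r with (pw k); [lra|]. rewrite pw_add in Hk2. simpl in Hk2. lra. }
  assert (Hfp : forall m, (0 <= m <= 2 ^ Z.of_nat p)%Z ->
    Rabs (RN p (a / b) - a / b) <= Rabs (2 * unit_roundoff p * IZR m - T) * pw k).
  { intros m Hm. rewrite <- (Rabs_right (pw k)) at 1 by lra. rewrite <- Rabs_mult.
    replace ((2 * unit_roundoff p * IZR m - T) * pw k)
      with (IZR m * pw (1 + - Z.of_nat p + k) - a / b).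
    - apply RN_nearest; [lia|]. apply fp_of_int; [lia|]. rewrite pow_IZR. apply IZR_le. lia.
    - rewrite ET, !pw_add, u_pw. simpl. ring. }
  assert (Hp1 : 2 * unit_roundoff p * IZR (2 ^ Z.of_nat (p - 1)) = 1).
  { rewrite <- pow_IZR. unfold unit_roundoff.
    replace p with (S (p - 1)) at 1 by lia. simpl pow. field.
    apply pow_nonzero; lra. }
  assert (Hpp : (2 ^ Z.of_nat p = 2 * 2 ^ Z.of_nat (p - 1))%Z).
  { replace (Z.of_nat p) with (Z.succ (Z.of_nat (p - 1))) by lia. apply Z.pow_succ_r; lia. }
  assert (Hpos : (1 < 2 ^ Z.of_nat (p - 1))%Z) by (apply Z.pow_gt_1; lia).
  set (P1 := (2 ^ Z.of_nat (p - 1))%Z) in *.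
  rewrite ET at 3.
  destruct (Req_dec T 1) as [E1|N1].
  { eapply Rle_trans; [apply (Hfp P1); lia|]. rewrite Hp1, E1, Rminus_diag, Rabs_R0.
    rewrite Rmult_0_l, Rmult_1_l. apply Rmult_le_pos; [apply Rmult_le_pos|]; lra. }
  assert (HTlow : 1 + unit_roundoff p / (1 - unit_roundoff p) <= T).
  { assert (HB0 : 0 < IZR B) by (apply IZR_lt; lia).
    assert (HA0 : 0 < IZR A) by (apply IZR_lt; lia).
    (* The power of two goes to whichever side keeps both terms integral. If it goes to the
       denominator, [D < N] still gives [D < 2 ^ p], since then [N] is a significand. From
       [N >= D + 1] follows [T >= 1 + 1 / (2 ^ p - 1)]. *)
    assert (ND : exists N D, T = IZR N / IZR D /\ (0 < D)%Z /\ (D < N -> D < 2 ^ Z.of_nat p)%Z).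
    { set (ea := (ka - Z.of_nat p + 1)%Z) in *. set (eb := (kb - Z.of_nat p + 1)%Z) in *.
      set (j := (ea + - eb + - k)%Z).
      assert (Ej : T * IZR B = IZR A * pw j).
      { unfold T, j. rewrite EA, EB, !pw_add, !powerRZ_neg'.
        assert (Hea := pw_pos ea). assert (Heb := pw_pos eb). field. lra. }
      destruct (Z_le_gt_dec 0 j) as [Hj|Hj].
      - exists (A * 2 ^ j)%Z, B. rewrite mult_IZR, <- pw_IZR, <- Ej by assumption.
        split; [field; lra | lia].
      - exists A, (B * 2 ^ (- j))%Z. split; [|nia].
        rewrite mult_IZR, <- pw_IZR, powerRZ_neg' by lia. pose proof (pw_pos j).
        replace (IZR A) with (T * IZR B / pw j) by (rewrite Ej; field; lra).
        field; lra. }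
    destruct ND as (N & D & EN & HD0 & HD).
    assert (HD0' : 0 < IZR D) by now apply IZR_lt.
    assert (EN' : T * IZR D = IZR N) by (rewrite EN; field; lra).
    assert (HND : (D < N)%Z) by (apply lt_IZR; nra).
    assert (HN1 : IZR D + 1 <= IZR N) by (rewrite <- plus_IZR; apply IZR_le; lia).
    assert (HD1 : IZR D + 1 <= / unit_roundoff p).
    { unfold unit_roundoff. rewrite Rinv_inv, pow_IZR, <- plus_IZR. apply IZR_le. lia. }
    set (u := unit_roundoff p) in *.
    assert (HDu : u * (IZR D + 1) <= 1).
    { apply Rmult_le_compat_l with (r := u) in HD1; [|lra]. rewrite Rinv_r in HD1; lra. }
    apply Rmult_le_reg_r with (IZR D * (1 - u)); [nra|].
    replace ((1 + u / (1 - u)) * (IZR D * (1 - u))) with (IZR D) by (field; lra).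
    nra. }
  destruct (Rle_dec T (1 + 3 * unit_roundoff p)) as [H3|H3].
  - eapply Rle_trans; [apply (Hfp (P1 + 1)%Z); lia|].
    rewrite plus_IZR, Rmult_plus_distr_l, Hp1, Rmult_1_r, <- Rmult_assoc.
    apply Rmult_le_compat_r; [lra|].
    apply div_scaled_err; lra.
  - eapply Rle_trans; [apply RN_err_binade; [lia | split; eassumption]|].
    rewrite <- Rmult_assoc. apply Rmult_le_compat_r; [lra|].
    set (u := unit_roundoff p) in *.
    assert ((1 - 2 * u) * (1 + 3 * u) <= (1 - 2 * u) * T) by (apply Rmult_le_compat_l; lra).
    assert (1 <= (1 - 2 * u) * T) by nra. nra.
Qed.

(** * Analysis of [phi] *)

Lemma sqrt2_sq : sqrt 2 * sqrt 2 = 2.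
Proof. apply sqrt_sqrt; lra. Qed.

Lemma sqrt2_bounds : 1.41421 < sqrt 2 < 1.41422.
Proof.
  assert (H := sqrt2_sq). assert (H0 := sqrt_pos 2). split; nra.
Qed.

(** Denominator of [phi] after clearing fractions, with [1 + 1 / (1 + sqrt 2) = sqrt 2]. Multiplying
    by it makes every claim on [phi] a polynomial one in [u], with powers of [sqrt 2] reduced by
    [w * w = 2]. *)
Definition phi_den u :=
  let w := sqrt 2 in
  w * (1 + u) * ((1 + w) * (1 + u) ^ 2 - u * (2 + u) * (1 + 2 * u) ^ 2).

Lemma phi_den_ge u : 0 <= u <= 1 / 32 -> 3 <= phi_den u.
Proof.
  intros Hu. unfold phi_den. assert (Hw := sqrt2_bounds). set (w := sqrt 2) in *.
  assert (2.4 <= (1 + w) * (1 + u) ^ 2 - u * (2 + u) * (1 + 2 * u) ^ 2).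
  { assert ((2 + u) * (1 + 2 * u) ^ 2 <= (2 + 1 / 32) * (1 + 2 * (1 / 32)) ^ 2).
    { apply Rmult_le_compat; try lra; [apply pow_le; lra | apply pow_incr; lra]. }
    assert (u * ((2 + u) * (1 + 2 * u) ^ 2) <= u * 2.3) by (apply Rmult_le_compat_l; lra).
    assert (2.4 * (1 + u * 2) <= (1 + w) * (1 + u) ^ 2) by nra. lra. }
  assert (1.41 <= w * (1 + u)) by nra. nra.
Qed.

Lemma phi_fraction u : 0 <= u <= 1 / 32 ->
  phi u * phi_den u =
  ((1 + sqrt 2) * (1 + u) ^ 2 - u * (2 + u) * (1 + 2 * u) ^ 2
   + (1 + u * (1 - 2 * u)) * (1 + u) ^ 2) * (1 + 2 * u) - phi_den u.
Proof.
  intros Hu. assert (HB := phi_den_ge u Hu). unfold phi, phi_den in *.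
  assert (Hw := sqrt2_bounds). assert (Hww := sqrt2_sq). set (w := sqrt 2) in *.
  replace (1 + 1 / (1 + w)) with w.
  2: { apply Rmult_eq_reg_r with (1 + w); [|lra].
       replace ((1 + 1 / (1 + w)) * (1 + w)) with (2 + w) by (field; lra). lra. }
  set (E := (1 + w) * (1 + u) ^ 2 - u * (2 + u) * (1 + 2 * u) ^ 2) in *.
  assert (HE : 0 < E) by (assert (0 < w * (1 + u)) by nra; nra).
  replace (1 + w - u * (2 + u) * (1 + 2 * u) ^ 2 / (1 + u) ^ 2) with (E / (1 + u) ^ 2)
    by (unfold E; field; lra).
  field. lra.
Qed.

Lemma phi_ge u : 0 <= u <= 1 / 32 -> (5 * sqrt 2 / 2 - 2) * u <= phi u.
Proof.
  intros Hu. assert (HB := phi_den_ge u Hu). assert (HF := phi_fraction u Hu).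
  apply Rmult_le_reg_r with (phi_den u); [lra|]. rewrite HF. unfold phi_den.
  assert (Hw := sqrt2_bounds). assert (Hww := sqrt2_sq). set (w := sqrt 2) in *.
  apply Rminus_le.
  (* The leading coefficient is [21 - 9 * w = (30 - 39 * w / 2) * (2 + w)]: the cubic coefficient of
     [phi] times [phi_den 0]. All four coefficients are positive. *)
  match goal with |- ?l <= 0 => replace l with
    (- (u ^ 3 * ((21 - 9 * w) + (68 - 29 * w) * u + (68 - 28 * w) * u ^ 2 + (20 - 8 * w) * u ^ 3)))
    by field [Hww] end.
  assert (H2 : 0 <= u ^ 2) by (apply pow_le; lra). assert (H3 : 0 <= u ^ 3) by (apply pow_le; lra).
  assert (0 <= (68 - 29 * w) * u) by (apply Rmult_le_pos; lra).
  assert (0 <= (68 - 28 * w) * u ^ 2) by (apply Rmult_le_pos; lra).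
  assert (0 <= (20 - 8 * w) * u ^ 3) by (apply Rmult_le_pos; lra).
  apply Ropp_le_cancel. rewrite Ropp_involutive, Ropp_0.
  apply Rmult_le_pos; lra.
Qed.

Lemma phi_le u : 0 <= u <= 1 / 32 -> phi u <= (5 * sqrt 2 / 2 - 2) * u + u ^ 2 / 12.
Proof.
  intros Hu. assert (HB := phi_den_ge u Hu). assert (HF := phi_fraction u Hu).
  apply Rmult_le_reg_r with (phi_den u); [lra|]. rewrite HF. unfold phi_den.
  assert (Hw := sqrt2_bounds). assert (Hww := sqrt2_sq). set (w := sqrt 2) in *.
  apply Rminus_le.
  match goal with |- ?l <= 0 => replace l with
    (- (u ^ 2 * (1 / 6 + w / 12 - (41 / 2 - 109 / 12 * w) * u - (135 / 2 - 85 / 3 * w) * u ^ 2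
        - (407 / 6 - 79 / 3 * w) * u ^ 3 - (20 - 20 / 3 * w) * u ^ 4 - w / 3 * u ^ 5)))
    by field [Hww] end.
  assert (H1 : forall n, 0 <= u ^ n) by (intros n; apply pow_le; lra).
  assert (H2 : u ^ 2 <= u / 32) by (simpl; nra).
  assert (H3 : u ^ 3 <= u / 1024) by (simpl; nra).
  assert (H4 : u ^ 4 <= u / 32768) by (simpl in *; nra).
  assert (H5 : u ^ 5 <= u / 32768) by (simpl in *; nra).
  apply Ropp_le_cancel. rewrite Ropp_involutive, Ropp_0.
  apply Rmult_le_pos; [apply H1|].
  assert (L : forall c d n, 0 <= c <= d -> c * u ^ n <= d * u ^ n)
    by (intros c d n Hc; apply Rmult_le_compat_r; [apply H1 | lra]).
  assert (L1 := L (41 / 2 - 109 / 12 * w) 7.66 1%nat ltac:(lra)).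
  assert (L2 := L (135 / 2 - 85 / 3 * w) 27.44 2%nat ltac:(lra)).
  assert (L3 := L (407 / 6 - 79 / 3 * w) 30.6 3%nat ltac:(lra)).
  assert (L4 := L (20 - 20 / 3 * w) 10.6 4%nat ltac:(lra)).
  assert (L5 := L (w / 3) 0.5 5%nat ltac:(lra)).
  rewrite pow_1 in L1. lra.
Qed.

Lemma phi_expansion u : 0 <= u <= 1 / 32 ->
  Rabs (phi u - ((5 * sqrt 2 / 2 - 2) * u + (30 - 39 * sqrt 2 / 2) * u ^ 3)) <= 30 * u ^ 4.
Proof.
  intros Hu. assert (HB := phi_den_ge u Hu). assert (HF := phi_fraction u Hu).
  apply Rmult_le_reg_r with (phi_den u); [lra|].
  rewrite <- (Rabs_right (phi_den u)) at 1 by lra. rewrite <- Rabs_mult, Rmult_minus_distr_r, HF.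
  apply Rle_trans with (30 * u ^ 4 * 3).
  2: { apply Rmult_le_compat_l; [|lra]. assert (0 <= u ^ 4) by (apply pow_le; lra). lra. }
  unfold phi_den.
  assert (Hw := sqrt2_bounds). assert (Hww := sqrt2_sq). set (w := sqrt 2) in *.
  match goal with |- Rabs ?l <= _ => replace l with
    (u ^ 4 * ((58 * w - 73) + (329 * w - 424) * u + (631 * w - 820) * u ^ 2
     + (480 * w - 624) * u ^ 3 + (120 * w - 156) * u ^ 4))
    by field [Hww] end.
  assert (H1 : forall n, 0 <= u ^ n <= 1).
  { intros n. split; [apply pow_le; lra|]. rewrite <- (pow1 n). apply pow_incr. lra. }
  assert (H2 := H1 2%nat). assert (H3 := H1 3%nat). assert (H4 := H1 4%nat).
  assert (H2' : u ^ 2 <= u / 32) by (simpl; nra).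
  assert (H3' : u ^ 3 <= u / 32) by (simpl in *; nra).
  assert (H4' : u ^ 4 <= u / 32) by (simpl in *; nra).
  assert (L : forall c d n, 0 <= c <= d -> 0 <= c * u ^ n <= d * u ^ n)
    by (intros c d n Hc; specialize (H1 n); split; [nra | apply Rmult_le_compat_r; lra]).
  assert (L1 := L (329 * w - 424) 42 1%nat ltac:(lra)).
  assert (L2 := L (631 * w - 820) 73 2%nat ltac:(lra)).
  assert (L3 := L (480 * w - 624) 55 3%nat ltac:(lra)).
  assert (L4 := L (120 * w - 156) 14 4%nat ltac:(lra)).
  rewrite pow_1 in L1.
  rewrite Rabs_right.
  - rewrite (Rmult_comm 30), Rmult_assoc. apply Rmult_le_compat_l; lra.
  - apply Rle_ge, Rmult_le_pos; lra.
Qed.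

(** * From the error of [z] to the error of the result *)

Lemma Rabs_div_sub_1 a h c : 0 < h -> Rabs (a - h) <= c * h -> Rabs (a / h - 1) <= c.
Proof.
  intros Hh H. replace (a / h - 1) with ((a - h) * / h) by (field; lra).
  rewrite Rabs_mult, (Rabs_right (/ h)) by (apply Rle_ge, Rlt_le, Rinv_0_lt_compat; lra).
  apply Rmult_le_reg_r with h; [lra|]. rewrite Rmult_assoc, Rinv_l; lra.
Qed.

(** With [A = 0.5355] and [B = 0.43], the claim amounts to [(1 + A) + (2 * A + B) * u + 2 * B * u^2
    <= (5 * sqrt 2 / 2 - 2) * (1 + u)]. [A] uses up the constant term, and [B] nearly all the slack
    then left in the linear one. *)
Lemma final_rounding p t h : (5 <= p)%nat -> 0 < t -> 0 < h ->
  let u := unit_roundoff p in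
  Rabs (t - h) <= (0.5355 + 0.43 * u) * u * h ->
  Rabs (RN p t / h - 1) <= (5 * sqrt 2 / 2 - 2) * u.
Proof.
  intros Hp Ht Hh u H. assert (Hu := u_pos p). assert (Hu' := u_le p Hp). fold u in Hu, Hu'.
  assert (H1 := RN_rel_pos p t ltac:(lia) Ht). fold u in H1.
  apply Rabs_div_sub_1; [assumption|].
  assert (H2 := Rabs_between _ _ H).
  assert (H3 : (1 + u) * Rabs (RN p t - t) <= u * t).
  { apply Rmult_le_compat_l with (r := 1 + u) in H1; [|lra].
    replace ((1 + u) * (u / (1 + u) * t)) with (u * t) in H1 by (field; lra). exact H1. }
  assert (H4 : Rabs (RN p t - h) <= Rabs (RN p t - t) + Rabs (t - h)).
  { replace (RN p t - h) with ((RN p t - t) + (t - h)) by ring. apply Rabs_triang. }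
  set (a := Rabs (RN p t - t)) in *.
  apply Rmult_le_reg_l with (1 + u); [lra|].
  apply Rle_trans with (u * h * (1 + (0.5355 + 0.43 * u) * u + (1 + u) * (0.5355 + 0.43 * u))).
  { nra. }
  replace ((1 + u) * ((5 * sqrt 2 / 2 - 2) * u * h))
    with (u * h * ((1 + u) * (5 * sqrt 2 / 2 - 2))) by ring.
  apply Rmult_le_compat_l; [nra|]. assert (Hw := sqrt2_bounds). nra.
Qed.

(** Everything follows from [s^2 - r^2 = 1], that is [1 / (r + s) = s - r]. *)
Lemma hypot_scaled x y : 0 < y <= x ->
  let r := x / y in let s := sqrt (1 + r * r) in
  1 <= r /\ 1.4142 <= s /\ 0 < r + s /\ s * s = 1 + r * r /\
  sqrt (x ^ 2 + y ^ 2) = y * s /\ x + y / (r + s) = y * s.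
Proof.
  intros Hxy r s. assert (Ex : x = r * y) by (unfold r; field; lra).
  assert (Hr : 1 <= r) by (apply Rmult_le_reg_r with y; lra).
  assert (Hss : s * s = 1 + r * r) by (apply sqrt_sqrt; nra).
  assert (Hs0 : 0 <= s) by apply sqrt_pos.
  assert (Hs : 1.4142 <= s) by nra.
  repeat split; try assumption; try lra.
  - rewrite <- (sqrt_square (y * s)) by nra. f_equal. rewrite Ex.
    replace (y * s * (y * s)) with (y * y * (s * s)) by ring. rewrite Hss. ring.
  - rewrite Ex. apply Rmult_eq_reg_r with (r + s); [|lra].
    replace ((r * y + y / (r + s)) * (r + s)) with (y * (r * (r + s) + 1)) by (field; lra).
    replace (y * s * (r + s)) with (y * (r * s + s * s)) by ring. rewrite Hss. ring.
Qed.

Lemma inv_err y z Z e : 0 < y -> 0 < Z -> 0 < Z - e -> Rabs (z - Z) <= e ->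
  Rabs (y / z - y / Z) * (z * Z) <= y * e.
Proof.
  intros Hy HZ He H. apply Rabs_between in H as H'.
  replace (y / z - y / Z) with (y * (Z - z) * / (z * Z)) by (field; lra).
  assert (0 < z * Z) by nra.
  rewrite Rabs_mult, (Rabs_right (/ (z * Z))) by (apply Rle_ge, Rlt_le, Rinv_0_lt_compat; lra).
  rewrite Rmult_assoc, Rinv_l, Rmult_1_r by lra.
  rewrite Rabs_mult, (Rabs_right y) by lra. rewrite Rabs_minus_sym.
  apply Rmult_le_compat_l; lra.
Qed.

(** The numerical hypothesis is the sum of the two error bounds, [u * (1 - 2 * u) * y / z] for the
    division and [y * e * u / (z * Z)] inherited from [z], multiplied by [z * Z / (u * y)], with [z]
    replaced by [Z - e * u] on the right. *)
Lemma final_unpaired p x y z e : (5 <= p)%nat -> is_fp p y -> is_fp p z -> 0 < y <= x ->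
  let u := unit_roundoff p in
  let s := sqrt (1 + x / y * (x / y)) in let Z := x / y + s in
  0 <= e -> 0 < Z - e * u -> Rabs (z - Z) <= e * u ->
  e + (1 - 2 * u) * Z <= (0.5355 + 0.43 * u) * s * Z * (Z - e * u) ->
  Rabs (RN p (x + RN p (y / z)) / sqrt (x ^ 2 + y ^ 2) - 1) <= (5 * sqrt 2 / 2 - 2) * u.
Proof.
  intros Hp Hfy Hfz Hxy u s Z He HZe Hz Hc.
  assert (Hu := u_pos p). assert (Hu' := u_le p Hp). fold u in Hu, Hu'.
  destruct (hypot_scaled x y Hxy) as (Hr & Hs & HZ & _ & -> & Eh). fold s in Hs, HZ, Eh |- *.
  fold Z in HZ, Eh. apply Rabs_between in Hz as Hz'.
  assert (Hz0 : 0 < z) by lra.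
  assert (Hyz : 0 < y / z) by (apply Rdiv_lt_0_compat; lra).
  assert (Hd := RN_div p y z ltac:(lia) Hfy Hfz ltac:(lra) Hz0). fold u in Hd.
  assert (Hi := inv_err y z Z (e * u) ltac:(lra) HZ HZe Hz).
  set (z2 := RN p (y / z)) in *.
  apply final_rounding; fold u; try assumption.
  - apply Rabs_between in Hd. assert (u * (1 - 2 * u) * (y / z) <= 1 * (y / z))
      by (apply Rmult_le_compat_r; nra). lra.
  - nra.
  - rewrite <- Eh at 1.
    assert (Ht : Rabs (x + z2 - (x + y / Z)) <= Rabs (z2 - y / z) + Rabs (y / z - y / Z)).
    { replace (x + z2 - (x + y / Z)) with ((z2 - y / z) + (y / z - y / Z)) by ring.
      apply Rabs_triang. }
    eapply Rle_trans; [exact Ht|]. apply Rmult_le_reg_r with (z * Z); [nra|].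
    rewrite Rmult_plus_distr_r.
    apply Rle_trans with (u * (1 - 2 * u) * (y / z) * (z * Z) + y * (e * u)).
    { apply Rplus_le_compat; [|assumption]. apply Rmult_le_compat_r; [nra | assumption]. }
    replace (u * (1 - 2 * u) * (y / z) * (z * Z) + y * (e * u))
      with (u * y * (e + (1 - 2 * u) * Z)) by (field; lra).
    replace ((0.5355 + 0.43 * u) * u * (y * s) * (z * Z))
      with (u * y * ((0.5355 + 0.43 * u) * s * Z * z)) by ring.
    apply Rmult_le_compat_l; [nra|]. eapply Rle_trans; [exact Hc|].
    apply Rmult_le_compat_l; [|lra]. apply Rmult_le_pos; [apply Rmult_le_pos|]; lra.
Qed.

(* If [x + z2] lies just above [2^k], where the last rounding is worst, then for
   [x] near [y] the quotient [y / z] is about [0.29 2^k], and its rounding error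
   is at most [u 2^(k-2)], less than [u (y / z)]. *)
Lemma final_paired p x y z e : (5 <= p)%nat -> is_fp p y -> is_fp p z -> 0 < y <= x ->
  let u := unit_roundoff p in
  let s := sqrt (1 + x / y * (x / y)) in let Z := x / y + s in
  0 <= e <= 3 -> Rabs (z - Z) <= e * u ->
  e <= (0.2855 + 0.29 * u) * s * Z * (Z - e * u) ->
  Rabs (RN p (x + RN p (y / z)) / sqrt (x ^ 2 + y ^ 2) - 1) <= (5 * sqrt 2 / 2 - 2) * u.
Proof.
  intros Hp Hfy Hfz Hxy u s Z He Hz Hc.
  assert (Hu := u_pos p). assert (Hu' := u_le p Hp). fold u in Hu, Hu'.
  destruct (hypot_scaled x y Hxy) as (Hr & Hs & HZ & _ & -> & Eh). fold s in Hs, HZ, Eh |- *.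
  fold Z in HZ, Eh. apply Rabs_between in Hz as Hz'.
  assert (HZ' : 2.41 <= Z) by (unfold Z; lra).
  assert (Heu : e * u <= 3 / 32) by nra.
  assert (Hz0 : 2.3 < z) by lra.
  assert (Hyz : 0 < y / z) by (apply Rdiv_lt_0_compat; lra).
  assert (Hd : Rabs (RN p (y / z) - y / z) <= u * (y / z)).
  { rewrite <- (Rabs_right (y / z)) at 3 by lra. apply RN_rel. lia. }
  assert (Hi := inv_err y z Z (e * u) ltac:(lra) HZ ltac:(lra) Hz).
  set (z2 := RN p (y / z)) in *.
  assert (Ht0 : 0 < x + z2).
  { apply Rabs_between in Hd. assert (u * (y / z) <= 1 * (y / z))
      by (apply Rmult_le_compat_r; nra). lra. }
  assert (Hh : 0 < y * s) by nra.
  set (h := y * s) in *.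
  assert (Ht : Rabs (x + z2 - h) <= Rabs (z2 - y / z) + Rabs (y / z - y / Z)).
  { rewrite <- Eh. replace (x + z2 - (x + y / Z)) with ((z2 - y / z) + (y / z - y / Z)) by ring.
    apply Rabs_triang. }
  destruct (binade (x + z2) Ht0) as (k & Hk1 & Hk2).
  destruct (Rle_lt_dec (y / z) (pw (k - 1))) as [Hq|Hq].
  - apply final_rounding; fold u; try assumption.
    assert (E4 : pw (k - 2) = pw k / 4) by (unfold Zminus; rewrite pw_add; simpl; field).
    assert (E2 : pw (k - 1) = pw k / 2) by (unfold Zminus; rewrite pw_add; simpl; field).
    assert (Hd' : Rabs (z2 - y / z) <= u * pw (k - 2)).
    { apply round_bound_pw; [lia|]. rewrite Rabs_right; lra. }
    assert (Hi' : Rabs (y / z - y / Z) <= (0.2855 + 0.29 * u) * u * h).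
    { apply Rmult_le_reg_r with (z * Z); [nra|]. eapply Rle_trans; [exact Hi|].
      replace ((0.2855 + 0.29 * u) * u * h * (z * Z))
        with (y * u * ((0.2855 + 0.29 * u) * s * Z * z)) by (unfold h; ring).
      replace (y * (e * u)) with (y * u * e) by ring.
      apply Rmult_le_compat_l; [nra|]. eapply Rle_trans; [exact Hc|].
      apply Rmult_le_compat_l; [|lra]. apply Rmult_le_pos; [apply Rmult_le_pos|]; lra. }
    rewrite E4 in Hd'.
    set (g := Rabs (x + z2 - h)) in *.
    assert (Hg : x + z2 <= h + g) by (unfold g; pose proof (Rle_abs (x + z2 - h)); lra).
    assert (Hg1 : g <= u / 4 * (h + g) + (0.2855 + 0.29 * u) * u * h).
    { assert (u * (pw k / 4) <= u / 4 * (h + g)) by nra. lra. }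
    apply Rmult_le_reg_l with (1 - u / 4); [lra|].
    apply Rle_trans with (u * h * (0.5355 + 0.29 * u)); [nra|].
    replace ((1 - u / 4) * ((0.5355 + 0.43 * u) * u * h))
      with (u * h * ((1 - u / 4) * (0.5355 + 0.43 * u))) by ring.
    apply Rmult_le_compat_l; nra.
  - apply Rabs_div_sub_1; [assumption|].
    assert (E2 : pw (k - 1) = pw k / 2) by (unfold Zminus; rewrite pw_add; simpl; field).
    assert (Hf := RN_err_binade p (x + z2) k ltac:(lia) (conj Hk1 Hk2)). fold u in Hf.
    assert (Hf' : u * pw k <= u * (2 * (y / z))) by (apply Rmult_le_compat_l; lra).
    assert (Ht' : Rabs (RN p (x + z2) - h)
      <= Rabs (RN p (x + z2) - (x + z2)) + Rabs (x + z2 - h)).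
    { replace (RN p (x + z2) - h) with ((RN p (x + z2) - (x + z2)) + (x + z2 - h)) by ring.
      apply Rabs_triang. }
    apply Rle_trans with (u * (3 * (y / z)) + Rabs (y / z - y / Z)); [lra|].
    apply Rmult_le_reg_r with (z * Z); [nra|].
    apply Rle_trans with (u * (3 * (y / z)) * (z * Z) + y * (e * u)); [nra|].
    replace (u * (3 * (y / z)) * (z * Z) + y * (e * u)) with (u * y * (3 * Z + e)) by (field; lra).
    replace ((5 * sqrt 2 / 2 - 2) * u * h * (z * Z))
      with (u * y * ((5 * sqrt 2 / 2 - 2) * s * z * Z)) by (unfold h; ring).
    apply Rmult_le_compat_l; [nra|].
    assert (Hw := sqrt2_bounds).
    assert (H1 : 1.53 * 1.4142 <= (5 * sqrt 2 / 2 - 2) * s) by (apply Rmult_le_compat; lra).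
    assert (H2 : 1.53 * 1.4142 * 2.3 <= (5 * sqrt 2 / 2 - 2) * s * z)
      by (apply Rmult_le_compat; lra).
    assert (H3 : 1.53 * 1.4142 * 2.3 * Z <= (5 * sqrt 2 / 2 - 2) * s * z * Z)
      by (apply Rmult_le_compat_r; lra).
    lra.
Qed.

(* The difference of the two sides is increasing in [s] and [Z] and concave in
   [u], so it suffices to test the corners. *)
Lemma corner_check A B C s0 Z0 E0 u s Z : 0 <= u <= 1 / 32 ->
  0 <= A -> 0 <= B -> 0 <= C -> 0 <= E0 -> 0 <= s0 <= s -> 1 <= Z0 <= Z -> E0 <= 31 ->
  C <= A * s0 * (2 * Z0 - 1) ->
  E0 + C * Z0 <= A * s0 * Z0 * Z0 ->
  E0 + 1 / 32 + C * (15 / 16) * Z0 <=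
    (A + B / 32) * s0 * Z0 * (Z0 - (E0 + 1 / 32) / 32) ->
  E0 + u + C * (1 - 2 * u) * Z <= (A + B * u) * s * Z * (Z - (E0 + u) * u).
Proof.
  intros Hu HA HB HC HE [Hs0 Hs] [HZ1 HZ] HE' H1 H2 H3.
  set (e' := E0 + 1 / 32) in *.
  assert (HAB : A <= A + B * u) by nra.
  (* This accounts for the [- 1] in the monotonicity hypothesis [C <= A * s0 * (2 * Z0 - 1)], and
     for the bound [31]. *)
  assert (He : e' * u <= 1) by (unfold e'; nra).
  apply Rle_trans with ((A + B * u) * s0 * Z * (Z - e' * u)).
  2: { apply Rmult_le_compat; [| nra | | unfold e'; nra].
       - apply Rmult_le_pos; [apply Rmult_le_pos|]; lra.
       - apply Rmult_le_compat_r; [lra|]. apply Rmult_le_compat_l; lra. }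
  set (G := A + B * u) in *.
  assert (HG : 0 <= (Z - Z0) * (G * s0 * (Z + Z0 - e' * u) - C * (1 - 2 * u))).
  { apply Rmult_le_pos; [lra|].
    assert (C * (1 - 2 * u) <= C) by nra.
    assert (A * s0 * (2 * Z0 - 1) <= G * s0 * (Z + Z0 - e' * u)).
    { apply Rmult_le_compat; try lra; [apply Rmult_le_pos; lra|].
      apply Rmult_le_compat_r; lra. }
    lra. }
  assert (Hg : 0 <= B * s0 * Z0 * e' * (u * (1 / 32 - u))).
  { apply Rmult_le_pos; [|apply Rmult_le_pos; lra].
    repeat apply Rmult_le_pos; unfold e'; lra. }
  assert (F0 : 0 <= (1 - 32 * u) * (A * s0 * Z0 * Z0 - (E0 + C * Z0)))
    by (apply Rmult_le_pos; lra).
  assert (F1 : 0 <= 32 * u * ((A + B / 32) * s0 * Z0 * (Z0 - e' / 32) -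
    (E0 + 1 / 32 + C * (15 / 16) * Z0))) by (apply Rmult_le_pos; unfold e' in *; lra).
  unfold G in *. clear G.
  (* The gain from [Z - Z0], a concavity remainder vanishing at [u = 0] and [u = 1 / 32], and the
     two endpoint tests with weights [1 - 32 * u] and [32 * u]. *)
  assert (ID : (A + B * u) * s0 * Z * (Z - e' * u) - (E0 + u + C * (1 - 2 * u) * Z) =
    (Z - Z0) * ((A + B * u) * s0 * (Z + Z0 - e' * u) - C * (1 - 2 * u)) +
    B * s0 * Z0 * e' * (u * (1 / 32 - u)) +
    (1 - 32 * u) * (A * s0 * Z0 * Z0 - (E0 + C * Z0)) +
    32 * u * ((A + B / 32) * s0 * Z0 * (Z0 - e' / 32) - (E0 + 1 / 32 + C * (15 / 16) * Z0)))
    by (field).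
  lra.
Qed.

(** * Error of [z] in the branch [x <= 2 * y] *)

Lemma Ph_Pl_bounds p : (5 <= p)%nat ->
  let Ph := RN p (1 + sqrt 2) in let Pl := RN p (1 + sqrt 2 - Ph) in
  let u := unit_roundoff p in
  Rabs (Ph + Pl - (1 + sqrt 2)) <= u * u /\ Rabs Pl <= 0.0405.
Proof.
  intros Hp Ph Pl u. assert (Hu := u_pos p). assert (Hu' := u_le p Hp). fold u in Hu, Hu'.
  assert (Hw := sqrt2_bounds).
  assert (H1 : Rabs (Ph - (1 + sqrt 2)) <= u * 2).
  { replace 2 with (pw 1) at 2 by (simpl; ring). apply round_bound_pw; [lia|].
    rewrite Rabs_right by lra. simpl. lra. }
  assert (H2 : Rabs (1 + sqrt 2 - Ph) <= 0.0393).
  (* For [p = 5] the general bound [2 * u = 1 / 16] is too coarse, but the float [19 / 8] is within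
     [0.0393] of [1 + sqrt 2]. The smaller [Pl] keeps the sums [r5] and [r6] in low binades. *)
  { rewrite Rabs_minus_sym. destruct (Nat.eq_dec p 5) as [->|Hn].
    - replace (19 / 8) with (IZR 19 * pw (-3)) by (simpl; lra).
      eapply Rle_trans; [apply (RN_nearest 5 _ (IZR 19 * pw (-3))); [lia|]|].
      + apply fp_of_int; [lia|]. simpl. lra.
      + simpl. rewrite Rabs_left1; lra.
    - assert (u <= 1 / 64); [|lra]. unfold u. rewrite u_pw.
      replace (1 / 64) with (pw (-6)) by (simpl; lra). apply pw_le. lia. }
  assert (H3 : Rabs (Pl - (1 + sqrt 2 - Ph)) <= u * u).
  { unfold u at 2. rewrite u_pw. apply round_bound_pw; [lia|].
    rewrite <- u_pw, Rabs_minus_sym. fold u. lra. }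
  split.
  - replace (Ph + Pl - (1 + sqrt 2)) with (Pl - (1 + sqrt 2 - Ph)) by ring. exact H3.
  - apply Rabs_between in H2, H3. assert (u * u <= 0.001) by nra. apply Rabs_le. lra.
Qed.

Lemma sqrt_diff a b c : 0 <= a -> 0 <= b -> 0 < c -> c <= sqrt a + sqrt b ->
  c * Rabs (sqrt a - sqrt b) <= Rabs (a - b).
Proof.
  intros Ha Hb Hc H.
  replace (a - b) with ((sqrt a + sqrt b) * (sqrt a - sqrt b)).
  - rewrite Rabs_mult, (Rabs_right (sqrt a + sqrt b)) by lra.
    apply Rmult_le_compat_r; [apply Rabs_pos | assumption].
  - replace (a - b) with (sqrt a * sqrt a - sqrt b * sqrt b) by (now rewrite !sqrt_sqrt). ring.
Qed.

(** With [s = sqrt (1 + (1 + eps)^2)] this evaluates [1 + eps + s] as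
    [(1 + sqrt 2) + eps + (s - sqrt 2)], using [s - sqrt 2 = (2 * eps + eps^2) / (sqrt 2 + s)]: the
    large part is a precomputed constant and the rest vanishes with [eps]. *)
Definition near_z p eps :=
  let RNp := RN p in
  let R2 := RNp (sqrt 2) in
  let Ph := RNp (1 + sqrt 2) in
  let Pl := RNp (1 + sqrt 2 - Ph) in
  let r2 := RNp eps in
  let tr2 := RNp (2 * r2) in
  let r3 := RNp (tr2 + r2 * r2) in
  let r4 := RNp (2 + r3) in
  let s2 := RNp (sqrt r4) in
  let d := RNp (R2 + s2) in
  let q := RNp (r3 / d) in
  let r5 := RNp (Pl + q) in
  let r6 := RNp (r5 + r2) in
  RNp (Ph + r6).

(** [E0] counts the roundings; the additional [u] pays for the [u * u] by which [Ph + Pl] misses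
    [1 + sqrt 2]. *)
Definition near_error p b E0 :=
  forall eps, 0 <= eps <= b ->
  let r := 1 + eps in
  Rabs (near_z p eps - (r + sqrt (1 + r * r))) <=
    (E0 + unit_roundoff p) * unit_roundoff p.

(* [kX] bounds the rounding error of the variable [X] in units of [u], and the
   total error of each variable, in the same unit, is [E3] for [r3], [Fs] for
   [sqrt r4], [Ed] for [d], [Fq] for [r3 / d], [Eq] for [q].  [S] bounds
   [sqrt (1 + (1 + eps)^2)], hence [S - 1.4142] bounds the exact value of [q]. *)
Lemma near_z_error p b S k2 k3 k4 ks kq k5 k6 kz Fq E0 :
  let c3 := k2 * (2 + 2 * b + k2 / 32) in
  let E3 := c3 + k3 in
  let Fs := (E3 + k4) / 2.73 in
  let Ed := 3 + Fs + ks in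
  let Eq := Fq + kq in
  let Pq := 0.0405 + (S - 1.4142) in
  (5 <= p)%nat ->
  0 <= b <= 1 -> 1 + (1 + b) * (1 + b) <= S * S -> 1.4143 <= S ->
  0 < k2 <= 1 -> 0 <= k3 -> 0 <= k4 -> 0 <= ks -> 0 <= kq -> 0 <= k5 -> 0 <= k6 ->
  E3 + k4 <= 8.05 -> 1.4143 + S + (Ed - 2) / 32 <= 4 ->
  E3 + (S - 1.4142) * Ed <= Fq * (2.8284 - Ed / 32) ->
  Eq + k2 + k5 + k6 + kz <= E0 ->
  round_bound p k2 b ->
  round_bound p k3 (2 * b + b * b + c3 / 32) ->
  round_bound p k4 (2 + 2 * b + b * b + E3 / 32) ->
  round_bound p ks (S + Fs / 32) ->
  round_bound p kq (S - 1.4142 + Fq / 32) ->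
  round_bound p k5 (Pq + Eq / 32) ->
  round_bound p k6 (Pq + b + (Eq + k2 + k5) / 32) ->
  round_bound p kz (1 + b + S + (1 / 32 + Eq + k2 + k5 + k6) / 32) ->
  near_error p b E0.
Proof.
  intros c3 E3 Fs Ed Eq Pq Hp Hb1 HS HS0 Hk2 Hk3 Hk4 Hks Hkq Hk5 Hk6 HE8 HT_d HFq HE0
    R2b R3b R4b Rsb Rqb R5b R6b Rzb eps [Heps Hb] r.
  assert (HE3 : c3 + k3 <= E3) by apply Rle_refl.
  assert (HFs : E3 + k4 <= 2.73 * Fs) by (unfold Fs; lra).
  assert (HEd : 3 + Fs + ks <= Ed) by apply Rle_refl.
  assert (HEq : Fq + kq <= Eq) by apply Rle_refl.
  assert (Hc3 : 0 <= c3) by (unfold c3; clear - Hk2 Hb1; nra).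
  assert (Ec3 : c3 = k2 * (2 + 2 * b + k2 / 32)) by reflexivity.
  clearbody c3 E3 Fs Ed Eq. unfold Pq in *. clear Pq.
  assert (Hu := u_pos p). assert (Hu' := u_le p Hp).
  destruct (Ph_Pl_bounds p Hp) as [HPP HPl].
  unfold near_z. cbv zeta.
  set (u := unit_roundoff p) in *.
  set (Ph := RN p (1 + sqrt 2)) in *. set (Pl := RN p (1 + sqrt 2 - Ph)) in *.
  assert (Hw := sqrt2_bounds). assert (Hww := sqrt2_sq).
  assert (HU : forall c, 0 <= c -> 0 <= c * u <= c / 32) by (intros c Hc; clear - Hc Hu Hu'; nra).
  assert (HR2 : Rabs (RN p (sqrt 2) - sqrt 2) <= u).
  { rewrite <- (Rmult_1_r u). change 1 with (pw 0). apply round_bound_pw; [lia|].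
    rewrite Rabs_right; simpl; lra. }
  set (R2 := RN p (sqrt 2)) in *.
  set (s := sqrt (1 + r * r)) in *.
  assert (Hss : s * s = 1 + r * r) by (apply sqrt_sqrt; clear; nra).
  assert (Hsw : sqrt 2 <= s) by (apply sqrt_le_1_alt; unfold r; clear - Heps; nra).
  assert (HsS : s <= S).
  { apply Rsqr_incr_0_var; [|lra]. unfold Rsqr. rewrite Hss. unfold r.
    clear - HS Heps Hb. nra. }
  set (w := sqrt 2) in *.
  set (rs := 2 * eps + eps * eps).
  assert (Hrs : 0 <= rs <= 2 * b + b * b) by (unfold rs; clear - Heps Hb; nra).
  assert (Hsrs : s * s = 2 + rs) by (rewrite Hss; unfold r, rs; ring).
  assert (D2 := R2b eps ltac:(rewrite Rabs_right; lra)). fold u in D2.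
  rewrite (RN_id p (2 * RN p eps)).
  2: lia.
  2: { destruct (RN_fp p eps ltac:(lia)) as (M & e & HM & E). exists M, (e + 1)%Z.
       split; [assumption|]. rewrite E, pw_add. simpl. ring. }
  set (r2 := RN p eps) in *.
  apply Rabs_between in D2.
  assert (Uk2 := HU k2 ltac:(lra)).
  assert (DX3 : Rabs (2 * r2 + r2 * r2 - rs) <= u * c3).
  { rewrite Ec3. replace (2 * r2 + r2 * r2 - rs) with ((r2 - eps) * (2 + 2 * eps + (r2 - eps)))
      by (unfold rs; ring).
    rewrite Rabs_mult, <- Rmult_assoc. apply Rmult_le_compat; try apply Rabs_pos;
      apply Rabs_le; lra. }
  apply Rabs_between in DX3. assert (Uc3 := HU c3 Hc3).
  assert (D3 := R3b (2 * r2 + r2 * r2) ltac:(apply Rabs_le; lra)). fold u in D3.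
  set (r3 := RN p (2 * r2 + r2 * r2)) in *. apply Rabs_between in D3.
  assert (D3' : - (E3 * u) <= r3 - rs <= E3 * u).
  { assert ((c3 + k3) * u <= E3 * u) by (apply Rmult_le_compat_r; lra). lra. }
  assert (UE3 := HU E3 ltac:(lra)).
  assert (D4 := R4b (2 + r3) ltac:(apply Rabs_le; lra)). fold u in D4.
  set (r4 := RN p (2 + r3)) in *. apply Rabs_between in D4.
  set (E4 := E3 + k4) in *.
  assert (UE4 := HU E4 ltac:(unfold E4; lra)).
  assert (D4' : Rabs (r4 - (1 + r * r)) <= E4 * u).
  { rewrite <- Hss, Hsrs. unfold E4. apply Rabs_le. lra. }
  (* [1.7424 = 1.32^2], from [2 - 8.05 / 32]. Then [1.32 + sqrt 2 >= 2.73], the divisor in [Fs]. *)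
  assert (Hr4 : 1.7424 <= r4).
  { apply Rabs_between in D4'. rewrite <- Hss, Hsrs in D4'. unfold E4 in *. lra. }
  assert (Hsr4 : 1.32 <= sqrt r4).
  { rewrite <- (sqrt_square 1.32) by lra. apply sqrt_le_1_alt. lra. }
  assert (DFs : Rabs (sqrt r4 - s) <= Fs * u).
  { assert (H := sqrt_diff r4 (1 + r * r) 2.73 ltac:(lra) ltac:(clear; nra) ltac:(lra)
      ltac:(fold s; lra)). fold s in H.
    assert (E4 * u <= 2.73 * Fs * u) by (apply Rmult_le_compat_r; lra). lra. }
  apply Rabs_between in DFs. assert (UFs := HU Fs ltac:(unfold E4 in *; lra)).
  assert (Ds := Rsb (sqrt r4) ltac:(apply Rabs_le; lra)). fold u in Ds.
  set (s2 := RN p (sqrt r4)) in *. apply Rabs_between in Ds. apply Rabs_between in HR2.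
  assert (UEd := HU Ed ltac:(unfold E4 in *; lra)).
  assert (UEd2 := HU (Ed - 2) ltac:(unfold E4 in *; lra)).
  assert (HEdu : (3 + Fs + ks) * u <= Ed * u) by (apply Rmult_le_compat_r; lra).
  assert (Dd : Rabs (RN p (R2 + s2) - (R2 + s2)) <= u * 2).
  { replace 2 with (pw 1) by (simpl; ring). apply round_bound_pw; [lia|].
    apply Rabs_le. simpl. lra. }
  set (d := RN p (R2 + s2)) in *. apply Rabs_between in Dd.
  assert (Dd' : Rabs (d - (w + s)) <= Ed * u) by (apply Rabs_le; lra).
  assert (Hd : 2.8284 - Ed / 32 <= d) by (apply Rabs_between in Dd'; lra).
  assert (Hdpos : 0 < 2.8284 - Ed / 32) by lra.
  set (Q := S - 1.4142) in *.
  assert (HFq0 : 0 <= Fq).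
  { assert (0 <= Q * Ed) by (apply Rmult_le_pos; unfold Q, E4 in *; lra).
    destruct (Rle_lt_dec 0 Fq) as [|Hneg]; [assumption|].
    assert (0 <= E3) by lra. clear - Hneg H H0 HFq Hdpos. nra. }
  (* Since [(s - w) * (s + w) = rs], the error of the quotient times [d] splits into the error of
     [r3] and [s - w] times the error of [d]. *)
  assert (DFq : Rabs (r3 / d - (s - w)) <= Fq * u).
  { apply Rmult_le_reg_r with d; [lra|].
    replace (r3 / d - (s - w)) with ((r3 - rs - (s - w) * (d - (w + s))) * / d).
    2: { replace rs with ((s - w) * (s + w)).
         - field. lra.
         - replace ((s - w) * (s + w)) with (s * s - w * w) by ring. lra. }
    rewrite Rabs_mult, (Rabs_right (/ d)) by (apply Rle_ge, Rlt_le, Rinv_0_lt_compat; lra).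
    rewrite Rmult_assoc, Rinv_l, Rmult_1_r by lra.
    apply Rle_trans with (E3 * u + Q * (Ed * u)).
    - eapply Rle_trans; [apply Rabs_triang|]. apply Rplus_le_compat.
      + apply Rabs_le. lra.
      + rewrite Rabs_Ropp, Rabs_mult. apply Rmult_le_compat; try apply Rabs_pos; try assumption.
        apply Rabs_le. unfold Q. lra.
    - apply Rle_trans with (Fq * (2.8284 - Ed / 32) * u).
      + replace (E3 * u + Q * (Ed * u)) with ((E3 + Q * Ed) * u) by ring.
        apply Rmult_le_compat_r; lra.
      + replace (Fq * u * d) with (Fq * d * u) by ring.
        apply Rmult_le_compat_r; [lra|]. apply Rmult_le_compat_l; lra. }
  apply Rabs_between in DFq. assert (UFq := HU Fq HFq0).
  assert (Dq := Rqb (r3 / d) ltac:(apply Rabs_le; unfold Q in *; lra)). fold u in Dq.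
  set (q := RN p (r3 / d)) in *. apply Rabs_between in Dq.
  assert (HEqu : (Fq + kq) * u <= Eq * u) by (apply Rmult_le_compat_r; lra).
  assert (UEq := HU Eq ltac:(lra)).
  apply Rabs_between in HPl.
  assert (D5 := R5b (Pl + q) ltac:(apply Rabs_le; unfold Q in *; lra)). fold u in D5.
  set (r5 := RN p (Pl + q)) in *. apply Rabs_between in D5.
  assert (Uk5 := HU k5 Hk5).
  assert (D6 := R6b (r5 + r2) ltac:(apply Rabs_le; unfold Q in *; lra)). fold u in D6.
  set (r6 := RN p (r5 + r2)) in *. apply Rabs_between in D6.
  assert (Uk6 := HU k6 Hk6). apply Rabs_between in HPP.
  assert (Huu : u * u <= 1 / 32 * (1 / 32)) by (apply Rmult_le_compat; lra).
  assert (Dz := Rzb (Ph + r6) ltac:(apply Rabs_le; unfold r in *; lra)). fold u in Dz.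
  set (z := RN p (Ph + r6)) in *. apply Rabs_between in Dz.
  assert (HE0u : (Eq + k2 + k5 + k6 + kz) * u <= E0 * u) by (apply Rmult_le_compat_r; lra).
  apply Rabs_le. unfold r. lra.
Qed.

(** * Interval certificates for [x <= 2 * y] *)

Lemma round_bound_cap p j k T : (2 <= p)%nat -> k = pw j -> T <= 2 * k -> round_bound p k T.
Proof. intros Hp -> HT t Ht. apply round_bound_pw; [assumption | lra]. Qed.

Lemma sqrt_ge a b : 0 <= a -> a * a <= b -> a <= sqrt b.
Proof. intros Ha H. rewrite <- (sqrt_square a) by assumption. now apply sqrt_le_1_alt. Qed.

Definition near_bound p x y :=
  Rabs (RN p (x + RN p (y / near_z p (x / y - 1))) / sqrt (x ^ 2 + y ^ 2) - 1)
    <= (5 * sqrt 2 / 2 - 2) * unit_roundoff p.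

Lemma near_unpaired p x y a b s0 E0 : (5 <= p)%nat -> is_fp p y -> 0 < y <= x ->
  near_error p b E0 -> a <= x / y - 1 <= b ->
  0 <= a -> 0 <= s0 -> s0 * s0 <= 1 + (1 + a) * (1 + a) -> 0 <= E0 <= 31 ->
  let Z0 := 1 + a + s0 in
  1 <= 0.5355 * s0 * (2 * Z0 - 1) ->
  E0 + Z0 <= 0.5355 * s0 * Z0 * Z0 ->
  E0 + 1 / 32 + 15 / 16 * Z0 <=
    (0.5355 + 0.43 / 32) * s0 * Z0 * (Z0 - (E0 + 1 / 32) / 32) ->
  near_bound p x y.
Proof.
  intros Hp Hy Hxy Herr Heps Ha Hs0 Hs0' HE0 Z0 C1 C2 C3.
  destruct (hypot_scaled x y Hxy) as (Hr & Hs & HZ & _).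
  assert (Hu := u_pos p). assert (Hu' := u_le p Hp).
  specialize (Herr (x / y - 1) ltac:(lra)). cbv zeta in Herr.
  replace (1 + (x / y - 1)) with (x / y) in Herr by ring.
  assert (Hss : s0 <= sqrt (1 + x / y * (x / y))) by (apply sqrt_ge; [assumption | nra]).
  assert (K := corner_check 0.5355 0.43 1 s0 Z0 E0 (unit_roundoff p)
    (sqrt (1 + x / y * (x / y))) (x / y + sqrt (1 + x / y * (x / y)))
    ltac:(lra) ltac:(lra) ltac:(lra) ltac:(lra) ltac:(lra) ltac:(lra)
    ltac:(unfold Z0; lra) ltac:(lra) C1 ltac:(lra) ltac:(lra)).
  unfold near_bound. apply (final_unpaired p x y _ (E0 + unit_roundoff p)); try assumption.
  - apply RN_fp. lia.
  - lra.
  (* Positivity of [Z - e * u] is read off from [K]: its left side is positive, and so are the other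
     factors on the right. *)
  - assert (0 < (E0 + unit_roundoff p) + (1 - 2 * unit_roundoff p)
      * (x / y + sqrt (1 + x / y * (x / y)))) by nra.
    set (Z := x / y + sqrt (1 + x / y * (x / y))) in *.
    apply Rmult_lt_reg_l with
      ((0.5355 + 0.43 * unit_roundoff p) * sqrt (1 + x / y * (x / y)) * Z).
    + apply Rmult_lt_0_compat; [apply Rmult_lt_0_compat|]; lra.
    + lra.
  - lra.
Qed.

Lemma near_paired p x y a b s0 E0 : (5 <= p)%nat -> is_fp p y -> 0 < y <= x ->
  near_error p b E0 -> a <= x / y - 1 <= b ->
  0 <= a -> 0 <= s0 -> s0 * s0 <= 1 + (1 + a) * (1 + a) -> 0 <= E0 <= 2.9 ->
  let Z0 := 1 + a + s0 in
  E0 <= 0.2855 * s0 * Z0 * Z0 ->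
  E0 + 1 / 32 <=
    (0.2855 + 0.29 / 32) * s0 * Z0 * (Z0 - (E0 + 1 / 32) / 32) ->
  near_bound p x y.
Proof.
  intros Hp Hy Hxy Herr Heps Ha Hs0 Hs0' HE0 Z0 C2 C3.
  destruct (hypot_scaled x y Hxy) as (Hr & Hs & HZ & _).
  assert (Hu := u_pos p). assert (Hu' := u_le p Hp).
  specialize (Herr (x / y - 1) ltac:(lra)). cbv zeta in Herr.
  replace (1 + (x / y - 1)) with (x / y) in Herr by ring.
  assert (Hss : s0 <= sqrt (1 + x / y * (x / y))) by (apply sqrt_ge; [assumption | nra]).
  assert (K := corner_check 0.2855 0.29 0 s0 Z0 E0 (unit_roundoff p)
    (sqrt (1 + x / y * (x / y))) (x / y + sqrt (1 + x / y * (x / y)))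
    ltac:(lra) ltac:(lra) ltac:(lra) ltac:(lra) ltac:(lra) ltac:(lra)
    ltac:(unfold Z0; lra) ltac:(lra)
    ltac:(apply Rmult_le_pos; unfold Z0; lra) ltac:(lra) ltac:(lra)).
  unfold near_bound. apply (final_paired p x y _ (E0 + unit_roundoff p)); try assumption.
  - apply RN_fp. lia.
  - lra.
  - lra.
Qed.

Ltac cap := first
  [ apply (round_bound_cap _ (-5)); [lia | simpl; lra | lra]
  | apply (round_bound_cap _ (-4)); [lia | simpl; lra | lra]
  | apply (round_bound_cap _ (-3)); [lia | simpl; lra | lra]
  | apply (round_bound_cap _ (-2)); [lia | simpl; lra | lra]
  | apply (round_bound_cap _ (-1)); [lia | simpl; lra | lra]
  | apply (round_bound_cap _ 0); [lia | simpl; lra | lra]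
  | apply (round_bound_cap _ 1); [lia | simpl; lra | lra]
  | apply (round_bound_cap _ 2); [lia | simpl; lra | lra] ].

Ltac near_cert S k2 k3 k4 ks kq k5 k6 kz Fq :=
  apply (near_z_error _ _ S k2 k3 k4 ks kq k5 k6 kz Fq);
  first [assumption | lra | cap].

(** On each interval the error is taken at the right end and the allowance ([s0], [Z0]) at the left
    end, so the intervals must be short where the two are close. To first order the paired and
    unpaired allowances agree when [s * Z = 4], at [x / y] about [1.134]; hence the change of method
    at [1/8]. *)
Lemma near_branch p x y : (5 <= p)%nat -> is_fp p y -> 0 < y <= x ->
  x <= 2 * y -> near_bound p x y.
Proof.
  intros Hp Hy Hxy Hx2.
  assert (H0 : 0 <= x / y - 1 <= 1).
  { split; apply Rmult_le_reg_r with y; try lra;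
      replace ((x / y - 1) * y) with (x - y) by (field; lra); lra. }
  destruct (Rle_lt_dec (x / y - 1) 0.045) as [H1|H1].
  { apply (near_paired p x y 0 0.045 1.4142 2.294); try assumption; try lra.
    (* [1.4464] is [sqrt (1 + 1.045^2)] rounded up. The final rounding alone contributes [2] to
       [E0 = 2.294]; the allowance is about [2.353]. *)
    near_cert 1.4464 (1/32) (1/16) 2 1 (1/32) (1/16) (1/16) 2 0.106. }
  destruct (Rle_lt_dec (x / y - 1) 0.085) as [H2|H2].
  { apply (near_paired p x y 0.045 0.085 1.4463 2.522); try assumption; try lra.
    near_cert 1.4756 (1/16) (1/8) 2 1 (1/16) (1/16) (1/8) 2 0.209. }
  destruct (Rle_lt_dec (x / y - 1) 0.11) as [H3|H3].
  { apply (near_paired p x y 0.085 0.11 1.4755 2.618); try assumption; try lra.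
    near_cert 1.4941 (1/16) (1/8) 2 1 (1/16) (1/8) (1/8) 2 0.243. }
  destruct (Rle_lt_dec (x / y - 1) (1/8)) as [H4|H4].
  { apply (near_paired p x y 0.11 (1/8) 1.494 2.812); try assumption; try lra.
    near_cert 1.5052 (1/16) (1/4) 2 1 (1/16) (1/8) (1/4) 2 0.312. }
  destruct (Rle_lt_dec (x / y - 1) 0.135) as [H5|H5].
  { apply (near_unpaired p x y (1/8) 0.135 1.5051 2.945); try assumption; try lra.
    near_cert 1.5127 (1/8) (1/4) 2 1 (1/16) (1/8) (1/4) 2 0.382. }
  destruct (Rle_lt_dec (x / y - 1) 0.15) as [H6|H6].
  { apply (near_unpaired p x y 0.135 0.15 1.5126 2.967); try assumption; try lra.
    near_cert 1.524 (1/8) (1/4) 2 1 (1/16) (1/8) (1/4) 2 0.404. }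
  destruct (Rle_lt_dec (x / y - 1) 0.22) as [H7|H7].
  { apply (near_unpaired p x y 0.15 0.22 1.5239 3.135); try assumption; try lra.
    near_cert 1.5775 (1/8) (1/4) 2 1 (1/8) (1/8) (1/4) 2 0.51. }
  destruct (Rle_lt_dec (x / y - 1) (1/4)) as [H8|H8].
  { apply (near_unpaired p x y 0.22 (1/4) 1.5774 3.656); try assumption; try lra.
    near_cert 1.6008 (1/8) (1/2) 2 1 (1/8) (1/4) (1/2) 2 0.656. }
  destruct (Rle_lt_dec (x / y - 1) 0.295) as [H9|H9].
  { apply (near_unpaired p x y (1/4) 0.295 1.6007 3.985); try assumption; try lra.
    near_cert 1.6362 (1/4) (1/2) 2 1 (1/8) (1/4) (1/2) 2 0.86. }
  destruct (Rle_lt_dec (x / y - 1) 0.425) as [H10|H10].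
  { apply (near_unpaired p x y 0.295 0.425 1.6361 4.553); try assumption; try lra.
    near_cert 1.7409 (1/4) 1 2 1 (1/4) (1/4) (1/2) 2 1.303. }
  destruct (Rle_lt_dec (x / y - 1) 0.505) as [H11|H11].
  { apply (near_unpaired p x y 0.425 0.505 1.7408 5.785); try assumption; try lra.
    near_cert 1.807 (1/2) 1 2 1 (1/4) (1/4) 1 2 1.785. }
  destruct (Rle_lt_dec (x / y - 1) 0.705) as [H12|H12].
  { apply (near_unpaired p x y 0.505 0.705 1.8069 6.982); try assumption; try lra.
    near_cert 1.9767 (1/2) 1 2 2 (1/2) (1/2) 1 2 2.482. }
  (* Past [0.705] the bounds on the arguments of [r3], [r4] and [z] exceed [2], [4] and [4], so
     [k3], [k4] and [kz] double. *)
  destruct (Rle_lt_dec (x / y - 1) 0.81) as [H13|H13].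
  { apply (near_unpaired p x y 0.705 0.81 1.9766 9.969); try assumption; try lra.
    near_cert 2.0679 (1/2) 2 4 2 (1/2) (1/2) 1 4 3.469. }
  destruct (Rle_lt_dec (x / y - 1) 0.99) as [H14|H14].
  { apply (near_unpaired p x y 0.81 0.99 2.0678 11.548); try assumption; try lra.
    near_cert 2.2272 (1/2) 2 4 2 (1/2) (1/2) 2 4 4.048. }
  apply (near_unpaired p x y 0.99 1 2.2271 12.08); try assumption; try lra.
  near_cert 2.2361 (1/2) 2 4 2 (1/2) 1 2 4 4.08.
Qed.

(** * The branch [x >= 2 * y] *)

Definition far_z p r :=
  let RNp := RN p in
  let rr := RNp r in
  let t := RNp (1 + rr * rr) in
  let s := RNp (sqrt t) in
  RNp (rr + s).

Lemma far_z_error p r : (5 <= p)%nat -> 2 <= r ->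
  let Z := r + sqrt (1 + r * r) in
  Rabs (far_z p r - Z) <= 3 * Z * unit_roundoff p.
Proof.
  intros Hp Hr Z. unfold far_z. cbv zeta.
  assert (Hu := u_pos p). assert (Hu' := u_le p Hp).
  assert (D1 := RN_rel p r ltac:(lia)). rewrite (Rabs_right r) in D1 by lra.
  set (rr := RN p r) in *. apply Rabs_between in D1.
  assert (D2 := RN_rel p (1 + rr * rr) ltac:(lia)). rewrite (Rabs_right (1 + _)) in D2 by nra.
  set (t := RN p (1 + rr * rr)) in *. apply Rabs_between in D2.
  assert (D3 := RN_rel p (sqrt t) ltac:(lia)).
  rewrite (Rabs_right (sqrt t)) in D3 by (apply Rle_ge, sqrt_pos).
  set (s' := RN p (sqrt t)) in *. apply Rabs_between in D3.
  assert (D4 := RN_rel p (rr + s') ltac:(lia)).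
  set (z := RN p (rr + s')) in *.
  set (s := sqrt (1 + r * r)) in *.
  assert (Hss : s * s = 1 + r * r) by (apply sqrt_sqrt; nra).
  assert (Hs0 : 0 < s) by (apply sqrt_lt_R0; nra).
  (* The computed square root has relative error up to [2.67 * u], the ratio only [u]. This
     comparison limits the weight of the former in the sum, so that with the last rounding the total
     stays below [3 * u]. *)
  assert (Hsr : s <= 1.2 * r) by (clear - Hss Hs0 Hr; nra).
  set (u := unit_roundoff p) in *. clearbody u s.
  assert (Drr : (1 - 2 * u) * (s * s) <= 1 + rr * rr <= (1 + 2.04 * u) * (s * s)).
  { rewrite Hss. assert (0 <= r * u) by (apply Rmult_le_pos; lra).
    assert (L : (r - u * r) * (r - u * r) <= rr * rr) by (apply Rmult_le_compat; nra).
    assert (M : rr * rr <= (r + u * r) * (r + u * r)) by (apply Rmult_le_compat; nra).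
    assert (0 <= r * r) by nra.
    clear - L M Hu Hu' H0. split; nra. }
  assert (Dt : Rabs (t - s * s) <= 3.12 * u * (s * s)).
  { assert (0 < s * s) by nra. set (q := s * s) in *. clearbody q.
    apply Rabs_le. clear - Drr D2 Hu Hu' H. nra. }
  assert (Ht : 0.9 * (s * s) <= t).
  { apply Rabs_between in Dt. assert (0 < s * s) by nra. nra. }
  assert (Hst : 0.94 * s <= sqrt t).
  { rewrite <- (sqrt_square (0.94 * s)) by lra. apply sqrt_le_1_alt. nra. }
  assert (Hs : sqrt (s * s) = s) by (apply sqrt_square; lra).
  assert (D5 : Rabs (sqrt t - s) <= 1.61 * u * s).
  { assert (H := sqrt_diff t (s * s) (1.94 * s) ltac:(nra) ltac:(nra) ltac:(lra) ltac:(lra)).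
    rewrite Hs in H. apply Rmult_le_reg_l with (1.94 * s); [lra|].
    assert (0 < s * s * u) by (apply Rmult_lt_0_compat; nra). nra. }
  apply Rabs_between in D5.
  assert (Hus : 0 < u * s) by nra. assert (Hur : 0 < u * r) by nra.
  assert (D6 : - (2.67 * u * s) <= s' - s <= 2.67 * u * s).
  { assert (u * sqrt t <= u * ((1 + 1.61 / 32) * s)) by (apply Rmult_le_compat_l; nra). lra. }
  assert (Hpos : 0 < rr + s') by nra.
  rewrite (Rabs_right (rr + s')) in D4 by lra. apply Rabs_between in D4.
  assert (u * r <= r / 32) by (clear - Hu' Hr; nra).
  assert (u * s <= s / 32) by (clear - Hu' Hs0; nra).
  assert (u * (rr + s') <= u * (r + s + (r + 2.67 * s) / 32))
    by (apply Rmult_le_compat_l; lra).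
  assert (u * s <= u * (1.2 * r)) by (apply Rmult_le_compat_l; lra).
  unfold Z. apply Rabs_le. lra.
Qed.

Lemma far_branch p x y : (5 <= p)%nat -> is_fp p y -> 0 < y -> 2 * y <= x ->
  Rabs (RN p (x + RN p (y / far_z p (x / y))) / sqrt (x ^ 2 + y ^ 2) - 1)
    <= (5 * sqrt 2 / 2 - 2) * unit_roundoff p.
Proof.
  intros Hp Hfy Hy Hxy.
  destruct (hypot_scaled x y ltac:(lra)) as (_ & _ & HZ & Hss & _).
  assert (Hr : 2 <= x / y).
  { apply Rmult_le_reg_r with y; [assumption|].
    unfold Rdiv. rewrite Rmult_assoc, Rinv_l; lra. }
  assert (Hu := u_pos p). assert (Hu' := u_le p Hp).
  assert (He := far_z_error p (x / y) Hp Hr). cbv zeta in He.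
  assert (Hs : 2.236 <= sqrt (1 + x / y * (x / y))) by (apply sqrt_ge; nra).
  apply (final_unpaired p x y _ (3 * (x / y + sqrt (1 + x / y * (x / y)))));
    try assumption; try lra.
  - apply RN_fp. lia.
  - nra.
  - set (s := sqrt (1 + x / y * (x / y))) in *. set (Z := x / y + s) in *.
    set (u := unit_roundoff p) in *.
    assert (HZ4 : 4.236 <= Z) by (unfold Z; lra).
    replace (3 * Z + (1 - 2 * u) * Z) with (Z * (4 - 2 * u)) by ring.
    replace ((0.5355 + 0.43 * u) * s * Z * (Z - 3 * Z * u))
      with (Z * ((0.5355 + 0.43 * u) * s * Z * (1 - 3 * u))) by ring.
    apply Rmult_le_compat_l; [lra|].
    assert (0.5355 * 2.236 * 4.236 <= (0.5355 + 0.43 * u) * s * Z).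
    { apply Rmult_le_compat; try lra. apply Rmult_le_compat; lra. }
    assert (0.5355 * 2.236 * 4.236 * (29 / 32) <= (0.5355 + 0.43 * u) * s * Z * (1 - 3 * u))
      by (apply Rmult_le_compat; lra).
    lra.
Qed.

Theorem theorem5 :
  (forall (p : nat), (5 <= p)%nat ->
   forall x y : R, is_fp p x -> is_fp p y -> 0 < y <= x ->
   Rabs (hypot_alg p x y / sqrt (x ^ 2 + y ^ 2) - 1) <= phi (unit_roundoff p))
  /\
  (exists C eps : R, 0 < eps /\
     forall u, 0 < u < eps ->
       Rabs (phi u - ((5 * sqrt 2 / 2 - 2) * u + (30 - 39 * sqrt 2 / 2) * u ^ 3))
         <= C * u ^ 4)
  /\
  (forall u, 0 <= u <= 1 / 32 ->
     phi u <= (5 * sqrt 2 / 2 - 2) * u + u ^ 2 / 12).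
Proof.
  split; [|split].
  - intros p Hp x y Hx Hy Hxy.
    assert (Hu := u_pos p). assert (Hu' := u_le p Hp).
    eapply Rle_trans; [|apply phi_ge; lra].
    unfold hypot_alg. cbv zeta. destruct (Rlt_dec y (RN p (x - y))) as [Hd|Hd].
    + apply far_branch; [assumption | assumption | lra |].
      destruct (Rle_lt_dec (2 * y) x) as [H|H]; [assumption|].
      (* [x < 2 * y] would give [x - y <= y], and rounding cannot pass the float [y], against the
         branch test. *)
      assert (H' := RN_le_fp p (x - y) y ltac:(lia) Hy ltac:(lra)). lra.
    + destruct (RN_sub_exact p x y ltac:(lia) Hx Hy Hxy ltac:(lra)) as [H1 H2].
      rewrite H2. replace ((x - y) / y) with (x / y - 1) by (field; lra).
      apply near_branch; try assumption. lra.
  - exists 30, (1 / 32). split; [lra|]. intros u Hu. apply phi_expansion. lra.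
  - exact phi_le.
Qed.
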